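(* Let $K\ge1$ and let $f=h+\overline{g}$ be a $K$-quasiregular harmonic mapping in the unit disk $\mathbb{D}$, with $h,g$ analytic in $\mathbb{D}$, such that $f(0)=0$ and $\lambda_f(0)=1$. If $|h'(z)|\leq M$ for all $z\in\mathbb{D}$, where $M$ is a constant, then $M\geq1$ and the following hold. (i) If $M>1$ (or if $M=1$ with $K>1$), then $f$ is univalent in the disk $\mathbb{D}_{r_6}$ and $f(\mathbb{D}_{r_6})$ contains a schlicht disk $\mathbb{D}_{r_7}$, where $$r_6=\frac{K+1}{2KM}\quad\text{and}\quad r_7=\frac{2KM}{K+1}+\left(\left(\frac{2KM}{K+1}\right)^3-\frac{2KM}{K+1}\right)\log\left(1-\left(\frac{K+1}{2KM}\right)^2\right).$$ The radius $r_6$ is best possible for $K=1$: for every $M>1$, the analytic function $$f_0(z)=\int_0^z M\,\frac{1-M\zeta}{M-\zeta}\,d\zeta$$ satisfies the hypotheses with $K=1$ and is not univalent in any disk $\mathbb{D}_r$ with $1/M<r\le1$. (ii) If $M=1$ and $K=1$, then $f$ is univalent in the entire unit disk $\mathbb{D}$ and $f(\mathbb{D})$ contains a schlicht disk $\mathbb{D}$.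
   Context: $\mathbb{D}_r(a)=\{z\in\mathbb{C}:|z-a|<r\}$, $\mathbb{D}_r=\mathbb{D}_r(0)$, $\mathbb{D}=\mathbb{D}_1$. A harmonic mapping in $\mathbb{D}$ is a complex-valued, twice continuously differentiable function $f$ with $4f_{z\bar z}=0$; it can be written $f=h+\overline{g}$ with $h,g$ analytic in $\mathbb{D}$. Put $\Lambda_f(z)=|f_z(z)|+|f_{\bar z}(z)|=|h'(z)|+|g'(z)|$, $\lambda_f(z)=\big||f_z(z)|-|f_{\bar z}(z)|\big|=\big||h'(z)|-|g'(z)|\big|$, and $J_f(z)=|h'(z)|^2-|g'(z)|^2$. The mapping $f$ is sense-preserving if $J_f>0$ in $\mathbb{D}$. A sense-preserving harmonic mapping $f$ is $K$-quasiregular ($K\ge1$) in $\mathbb{D}$ if $\Lambda_f(z)\le K\lambda_f(z)$ for all $z\in\mathbb{D}$. Univalent means injective. A disk $\mathbb{D}_\rho(a)$ is a schlicht disk of $f$ if there is a subdomain $\Omega\subset\mathbb{D}$ such that $f$ is univalent in $\Omega$ and $f(\Omega)=\mathbb{D}_\rho(a)$; ''$f(\mathbb{D}_r)$ contains a schlicht disk $\mathbb{D}_\rho$'' means that $\Omega$ can be taken inside $\mathbb{D}_r$.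
   Formalization: Sense-preserving is taken to mean J_f > 0 except at isolated points, rather than J_f > 0 everywhere in the disk, because f_0'(1/M) = 0 makes J_{f_0} vanish at 1/M, so f_0 would not satisfy the hypotheses as literally stated. *)

(* Defs.v *)
From Stdlib Require Import Reals Lra.
From Coquelicot Require Import Coquelicot.
Open Scope R_scope.

Definition disk (a : C) (r : R) : C -> Prop := fun z => Cmod (z - a) < r.

Definition unit_disk : C -> Prop := disk 0 1.

Definition dx (f : C -> C) (z : C) : C :=
  (Derive (fun t => Re (f (t, Im z))) (Re z),
   Derive (fun t => Im (f (t, Im z))) (Re z)).

Definition dy (f : C -> C) (z : C) : C :=
  (Derive (fun t => Re (f (Re z, t))) (Im z),
   Derive (fun t => Im (f (Re z, t))) (Im z)).

Definition dz (f : C -> C) (z : C) : C := ((dx f z - Ci * dy f z) / 2)%C.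

Definition dzbar (f : C -> C) (z : C) : C := ((dx f z + Ci * dy f z) / 2)%C.

(* [ex_diff_n u 2 x y] only speaks of the point (x, y): all partial derivatives
   of u of order at most 2 exist and are continuous there.  Required at every
   point of the (open) unit disk, it says that u is C^2 on the disk. *)
Definition C2_on_disk (f : C -> C) : Prop :=
  forall z, unit_disk z ->
    ex_diff_n (fun x y => Re (f (x, y))) 2 (Re z) (Im z) /\
    ex_diff_n (fun x y => Im (f (x, y))) 2 (Re z) (Im z).

Definition harmonic_mapping (f : C -> C) : Prop :=
  C2_on_disk f /\
  forall z, unit_disk z -> (4 * dzbar (dz f) z)%C = 0%C.

Definition analytic_on_disk (h : C -> C) : Prop :=
  forall z, unit_disk z ->
    ex_derive (K := C_AbsRing) (V := C_NormedModule) h z.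

Definition canonical_decomposition (f h g : C -> C) : Prop :=
  analytic_on_disk h /\ analytic_on_disk g /\
  forall z, unit_disk z -> f z = (h z + Cconj (g z))%C.

Definition Lambda (f : C -> C) (z : C) : R := Cmod (dz f z) + Cmod (dzbar f z).

Definition lambda (f : C -> C) (z : C) : R :=
  Rabs (Cmod (dz f z) - Cmod (dzbar f z)).

Definition jacobian (f : C -> C) (z : C) : R :=
  Cmod (dz f z) ^ 2 - Cmod (dzbar f z) ^ 2.

(* J_f > 0 off a set of isolated points, which are allowed as branch points of
   f.  If J_f > 0 were required at every point, an analytic function whose
   derivative vanishes somewhere in the disk, such as [extremal M] below at
   1 / M, would not be 1-quasiregular. *)
Definition sense_preserving (f : C -> C) : Prop :=
  forall z0, unit_disk z0 ->
    exists eps, 0 < eps /\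
      forall z, unit_disk z -> z <> z0 -> disk z0 eps z -> 0 < jacobian f z.

Lemma sense_preserving_jacobian_gt0 (f : C -> C) :
  (forall z, unit_disk z -> 0 < jacobian f z) -> sense_preserving f.
Proof.
  intros Hf z0 _. exists 1. split; [lra|]. intros z Hz _ _. exact (Hf z Hz).
Qed.

Definition quasiregular (K : R) (f : C -> C) : Prop :=
  1 <= K /\ harmonic_mapping f /\ sense_preserving f /\
  forall z, unit_disk z -> Lambda f z <= K * lambda f z.

Definition univalent_on (A : C -> Prop) (f : C -> C) : Prop :=
  forall z1 z2, A z1 -> A z2 -> f z1 = f z2 -> z1 = z2.

Definition connected_set (A : C -> Prop) : Prop :=
  forall U V : C -> Prop,
    open (T := C_UniformSpace) U -> open (T := C_UniformSpace) V ->
    (forall z, A z -> U z \/ V z) ->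
    (exists z, A z /\ U z) -> (exists z, A z /\ V z) ->
    exists z, A z /\ U z /\ V z.

Definition domain (Omega : C -> Prop) : Prop :=
  (exists z, Omega z) /\ open (T := C_UniformSpace) Omega /\
  connected_set Omega.

(* f(G) contains the schlicht disk D_rho(a). *)
Definition contains_schlicht_disk
    (f : C -> C) (G : C -> Prop) (a : C) (rho : R) : Prop :=
  exists Omega : C -> Prop,
    domain Omega /\ (forall z, Omega z -> G z) /\ univalent_on Omega f /\
    forall w, (exists z, Omega z /\ f z = w) <-> disk a rho w.

Definition hypotheses (K M : R) (f h g : C -> C) : Prop :=
  quasiregular K f /\ canonical_decomposition f h g /\
  f 0%C = 0%C /\ lambda f 0%C = 1 /\
  forall z, unit_disk z -> Cmod (C_derive h z) <= M.

Definition r6 (K M : R) : R := (K + 1) / (2 * K * M).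

Definition r7 (K M : R) : R :=
  2 * K * M / (K + 1) +
  ((2 * K * M / (K + 1)) ^ 3 - 2 * K * M / (K + 1)) *
    ln (1 - ((K + 1) / (2 * K * M)) ^ 2).

Definition segment_integral (phi : C -> C) (a b : C) : C :=
  RInt (V := C_R_CompleteNormedModule)
    (fun t : R => (phi (a + t * (b - a)) * (b - a))%C) 0 1.

(* The integrand is analytic on the unit disk when M > 1, so the integral from
   0 to z can be taken along the segment. *)
Definition extremal (M : R) (z : C) : C :=
  segment_integral (fun zeta => (M * ((1 - M * zeta) / (M - zeta)))%C) 0%C z.

(* Main.v *)
Require Import Defs.
From Stdlib Require Import Reals Lra Lia Classical ClassicalEpsilon Ranalysis5.
From Coquelicot Require Import Coquelicot.
Open Scope R_scope.

(** Put [L = 2KM/(K+1)].  For every unimodular [e] the analytic function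
    [F_e = h + e g] satisfies [|F_e'| <= L] and [|F_e'(0)| >= 1], so Schwarz-Pick
    applied to [F_e' / L] gives, after a rotation [c],
    [Re (c F_e'(z)) >= L (1 - L|z|) / (L - |z|)], which is positive for
    [|z| < 1/L = r6].  Given two points, [e] can be chosen so that the increment
    of [F_e] between them is at most that of [f] in modulus; hence [f] is
    injective on the disk of radius [r6], with a locally Lipschitz inverse, and
    integration along rays bounds [|f(z)|] below by a function of [|z|] with value
    [r7] at [r6].  As [f] is a local diffeomorphism, continuation along rays shows
    that the disk of radius [r7] is covered.  Schwarz-Pick itself comes from the
    mean value property over circles; as [f] is of class C^2, [h'] and [g'] are
    continuously differentiable, so differentiating under the integral sign
    suffices. *)

(** * Complex differentiability *)

(** The constant [L] is a bound for [|h'| + |g'|]: quasiregularity amounts to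
    [(K + 1) |g'| <= (K - 1) |h'|], so the sum is at most [(1 + (K - 1)/(K + 1)) M = L]. The
    normalization at 0 reads [|h'(0)| - |g'(0)| = 1]; this gives [|F_e'(0)| >= 1] for every [e] at
    once, and [M >= |h'(0)| >= 1]. As branch points are allowed, the first inequality is obtained
    where the Jacobian is positive and extended by continuity. Two obstacles shape the analytic
    part. The quotient [psi(z) / z] in the Schwarz lemma is known to be continuous at 0 but not to
    be differentiable there, so the mean value property and the maximum principle are formulated for
    functions that are holomorphic off one point and continuous at it. And [F_e' / L] may have
    modulus 1, which does happen for [K = M = 1]; Schwarz-Pick is therefore proved first under a
    bound [s < 1] and then by scaling. Part (ii) is the same argument at [L = 1], where the lower
    bound for [Re (c F_e')] is constantly 1 and both radii become 1. *)

Lemma im_le_Cmod (c : C) : Rabs (Im c) <= Cmod c.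
Proof.
  eapply Rle_trans; [apply Rmax_r|]. apply (Rmax_Cmod c).
Qed.

Lemma Cmod_le_abs_re_im (c : C) : Cmod c <= Rabs (Re c) + Rabs (Im c).
Proof.
  assert (H := Cmod2_alt c).
  apply Rsqr_incr_0_var.
  - unfold Rsqr. rewrite <- (pow2_abs (Re c)), <- (pow2_abs (Im c)) in H.
    pose proof (Rabs_pos (Re c)). pose proof (Rabs_pos (Im c)). nra.
  - pose proof (Rabs_pos (Re c)). pose proof (Rabs_pos (Im c)). lra.
Qed.

Lemma Cmod_minus_sym (z w : C) : Cmod (z - w) = Cmod (w - z).
Proof. rewrite <- Cmod_opp. f_equal. ring. Qed.

Lemma Cmod_triangle_rev (a b : C) : Cmod a - Cmod b <= Cmod (a + b).
Proof.
  replace a with ((a + b) + - b)%C at 1 by ring.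
  pose proof (Cmod_triangle (a + b) (- b)). rewrite Cmod_opp in H. lra.
Qed.

Lemma Cmod_triangle_minus (a b : C) : Cmod a - Cmod b <= Cmod (a - b).
Proof.
  unfold Cminus. rewrite <- (Cmod_opp b). apply Cmod_triangle_rev.
Qed.

Lemma re_minus (a b : C) : Re (a - b) = Re a - Re b.
Proof. reflexivity. Qed.

Lemma im_minus (a b : C) : Im (a - b) = Im a - Im b.
Proof. reflexivity. Qed.

Lemma Cminus_eq_0 (a b : C) : (a - b)%C = 0%C -> a = b.
Proof.
  intros H. replace a with (a - b + b)%C by ring. rewrite H. ring.
Qed.

Lemma disk_Cmod (r : R) (z : C) : disk 0%C r z <-> Cmod z < r.
Proof. unfold disk. replace (z - 0)%C with z by ring. easy. Qed.

Lemma unit_disk_Cmod (z : C) : unit_disk z <-> Cmod z < 1.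
Proof. apply disk_Cmod. Qed.

Lemma unit_disk_0 : unit_disk 0%C.
Proof. rewrite unit_disk_Cmod, Cmod_0. lra. Qed.

(** A common ground for three notions of neighbourhood: estimates use [Cmod], partial derivatives
    use [locally_2d], and [open] uses [locally]. The translations are [cnear_2d] and
    [cnear_locally]. *)
Definition cnear (z : C) (P : C -> Prop) : Prop :=
  exists d, 0 < d /\ forall w, Cmod (w - z) < d -> P w.

Lemma cnear_and (z : C) (P Q : C -> Prop) :
  cnear z P -> cnear z Q -> cnear z (fun w => P w /\ Q w).
Proof.
  intros [d [Hd H]] [e [He K]]. exists (Rmin d e). split.
  - now apply Rmin_pos.
  - intros w Hw. split; [apply H | apply K];
      (eapply Rlt_le_trans; [exact Hw|]); [apply Rmin_l | apply Rmin_r].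
Qed.

Lemma cnear_impl (z : C) (P Q : C -> Prop) :
  (forall w, P w -> Q w) -> cnear z P -> cnear z Q.
Proof. intros H [d [Hd K]]. exists d. auto. Qed.

Lemma cnear_self (z : C) (P : C -> Prop) : cnear z P -> P z.
Proof.
  intros [d [Hd K]]. apply K. replace (z - z)%C with (RtoC 0) by ring.
  now rewrite Cmod_0.
Qed.

Lemma cnear_disk (a z : C) (r : R) : disk a r z -> cnear z (disk a r).
Proof.
  unfold disk. intros H. exists (r - Cmod (z - a)). split; [lra|].
  intros w Hw. replace (w - a)%C with ((w - z) + (z - a))%C by ring.
  eapply Rle_lt_trans; [apply Cmod_triangle|]. lra.
Qed.

Lemma cnear_neq (z a : C) : z <> a -> cnear z (fun w => w <> a).
Proof.
  intros H. exists (Cmod (a - z)). split.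
  - apply Cmod_gt_0. intros E. apply H. symmetry. now apply Cminus_eq_0.
  - intros w Hw E. subst. lra.
Qed.

Lemma cnear_2d (z : C) (P : C -> Prop) :
  cnear z P <-> locally_2d (fun x y => P (x, y)) (Re z) (Im z).
Proof.
  destruct z as [a b]. simpl. split.
  - intros [d [Hd H]].
    assert (Hd2 : 0 < d / 2) by lra.
    exists (mkposreal _ Hd2). simpl. intros u v Hu Hv. apply H.
    eapply Rle_lt_trans; [apply Cmod_le_abs_re_im|]. simpl.
    unfold Rminus in *. lra.
  - intros [d H]. exists d. split; [apply cond_pos|].
    intros [u v] Hw. apply H.
    + eapply Rle_lt_trans; [|exact Hw]. apply (re_le_Cmod ((u, v) - (a, b))%C).
    + eapply Rle_lt_trans; [|exact Hw]. apply (im_le_Cmod ((u, v) - (a, b))%C).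
Qed.

Definition ccont (F : C -> C) (z : C) : Prop :=
  forall eps, 0 < eps -> cnear z (fun w => Cmod (F w - F z) < eps).

Lemma ccont_2d (F : C -> C) (z : C) :
  ccont F z <->
  continuity_2d_pt (fun x y => Re (F (x, y))) (Re z) (Im z) /\
  continuity_2d_pt (fun x y => Im (F (x, y))) (Re z) (Im z).
Proof.
  split.
  - intros H. split; intros eps; destruct z as [a b];
      apply (cnear_2d (a, b)
        (fun w => Rabs (_ (F w) - _ (F (a, b))) < eps));
      (eapply cnear_impl; [|apply (H eps (cond_pos eps))]); intros w Hw;
      simpl; (eapply Rle_lt_trans; [|exact Hw]).
    + apply (re_le_Cmod (F w - F (a, b))%C).
    + apply (im_le_Cmod (F w - F (a, b))%C).
  - intros [H1 H2] eps Heps.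
    assert (Heps2 : 0 < eps / 2) by lra.
    specialize (H1 (mkposreal _ Heps2)). specialize (H2 (mkposreal _ Heps2)).
    destruct z as [a b].
    apply (cnear_2d (a, b) (fun w => Rabs (Re (F w) - Re (F (a, b))) < eps / 2))
      in H1.
    apply (cnear_2d (a, b) (fun w => Rabs (Im (F w) - Im (F (a, b))) < eps / 2))
      in H2.
    eapply cnear_impl; [|exact (cnear_and _ _ _ H1 H2)].
    intros w [K1 K2]. eapply Rle_lt_trans; [apply Cmod_le_abs_re_im|].
    rewrite re_minus, im_minus. simpl in *. lra.
Qed.

Lemma ccont_ext_near (F G : C -> C) (z : C) :
  cnear z (fun w => F w = G w) -> ccont F z -> ccont G z.
Proof.
  intros H K eps Heps.
  eapply cnear_impl; [|exact (cnear_and _ _ _ H (K eps Heps))].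
  intros w [E Hw]. rewrite <- E, <- (cnear_self _ _ H). exact Hw.
Qed.

Lemma ccont_const (c z : C) : ccont (fun _ => c) z.
Proof.
  apply ccont_2d. split; apply continuity_2d_pt_const.
Qed.

Lemma ccont_id (z : C) : ccont (fun w => w) z.
Proof.
  intros eps Heps. exists eps. auto.
Qed.

Lemma ccont_plus (F G : C -> C) (z : C) :
  ccont F z -> ccont G z -> ccont (fun w => F w + G w)%C z.
Proof.
  intros HF HG. apply ccont_2d in HF, HG. apply ccont_2d.
  split; now apply continuity_2d_pt_plus.
Qed.

Lemma ccont_mult (F G : C -> C) (z : C) :
  ccont F z -> ccont G z -> ccont (fun w => F w * G w)%C z.
Proof.
  intros HF HG. apply ccont_2d in HF, HG. apply ccont_2d. split.
  - apply continuity_2d_pt_minus; now apply continuity_2d_pt_mult.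
  - apply continuity_2d_pt_plus; now apply continuity_2d_pt_mult.
Qed.

Lemma ccont_opp (F : C -> C) (z : C) :
  ccont F z -> ccont (fun w => - F w)%C z.
Proof.
  intros HF. apply ccont_2d in HF. apply ccont_2d.
  split; now apply continuity_2d_pt_opp.
Qed.

Lemma ccont_minus (F G : C -> C) (z : C) :
  ccont F z -> ccont G z -> ccont (fun w => F w - G w)%C z.
Proof. intros HF HG. apply ccont_plus; [assumption|]. now apply ccont_opp. Qed.

Lemma ccont_conj (F : C -> C) (z : C) :
  ccont F z -> ccont (fun w => Cconj (F w)) z.
Proof.
  intros H eps Heps. eapply cnear_impl; [|exact (H eps Heps)].
  intros w Hw. now rewrite <- Cminus_conj, Cmod_conj.
Qed.

Lemma ccont_inv (F : C -> C) (z : C) :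
  ccont F z -> F z <> 0%C -> ccont (fun w => / F w)%C z.
Proof.
  intros HF Hz. apply ccont_2d in HF. apply ccont_2d.
  assert (HN : Re (F z) ^ 2 + Im (F z) ^ 2 <> 0).
  { rewrite <- Cmod2_alt. apply pow_nonzero. apply Rgt_not_eq.
    now apply Cmod_gt_0. }
  assert (Hinv : continuity_2d_pt
    (fun x y => / (Re (F (x, y)) ^ 2 + Im (F (x, y)) ^ 2)) (Re z) (Im z)).
  { apply continuity_2d_pt_inv.
    - apply continuity_2d_pt_plus; simpl;
        repeat apply continuity_2d_pt_mult; try apply HF;
        apply continuity_2d_pt_const.
    - destruct z; exact HN. }
  split.
  - apply continuity_2d_pt_mult; [apply HF | exact Hinv].
  - apply continuity_2d_pt_mult; [apply continuity_2d_pt_opp, HF | exact Hinv].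
Qed.

Lemma ccont_comp (F G : C -> C) (z : C) :
  ccont F z -> ccont G (F z) -> ccont (fun w => G (F w)) z.
Proof.
  intros HF HG eps Heps. destruct (HG eps Heps) as [d [Hd H]].
  eapply cnear_impl; [|exact (HF d Hd)]. intros w Hw. now apply H.
Qed.

Lemma ccont_near_ne0 (F : C -> C) (z : C) :
  ccont F z -> F z <> 0%C -> cnear z (fun w => F w <> 0%C).
Proof.
  intros HF Hz. apply Cmod_gt_0 in Hz.
  eapply cnear_impl; [|exact (HF _ Hz)]. intros w Hw E. cbv beta in Hw.
  rewrite E in Hw. revert Hw. replace (0 - F z)%C with (- F z)%C by ring.
  rewrite Cmod_opp. lra.
Qed.

Lemma ccont_near_lt (F : C -> C) (z : C) (r : R) :
  ccont F z -> Cmod (F z) < r -> cnear z (fun w => Cmod (F w) < r).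
Proof.
  intros HF Hz.
  assert (Hp : 0 < r - Cmod (F z)) by lra.
  eapply cnear_impl; [|exact (HF _ Hp)]. intros w Hw.
  replace (F w) with ((F w - F z) + F z)%C by ring.
  eapply Rle_lt_trans; [apply Cmod_triangle|]. simpl in Hw. lra.
Qed.

(* Caratheodory's form of complex differentiability, which makes the rules of
   calculus algebraic identities. *)
Definition cderiv (F : C -> C) (z l : C) : Prop :=
  exists Q, ccont Q z /\ Q z = l /\
    cnear z (fun w => F w = (F z + Q w * (w - z))%C).

Lemma cderiv_ccont (F : C -> C) (z l : C) : cderiv F z l -> ccont F z.
Proof.
  intros [Q [HQ [_ H]]].
  apply ccont_ext_near with (fun w => F z + Q w * (w - z))%C.
  - eapply cnear_impl; [|exact H]. intros w Hw. now symmetry.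
  - apply ccont_plus; [apply ccont_const|]. apply ccont_mult; [exact HQ|].
    apply ccont_minus; [apply ccont_id | apply ccont_const].
Qed.

Lemma cderiv_ext_near (F G : C -> C) (z l : C) :
  cnear z (fun w => F w = G w) -> cderiv F z l -> cderiv G z l.
Proof.
  intros E [Q [HQ [Hl H]]]. exists Q. repeat split; try assumption.
  eapply cnear_impl; [|exact (cnear_and _ _ _ E H)].
  intros w [E1 E2]. rewrite <- E1, E2. now rewrite (cnear_self _ _ E).
Qed.

Lemma cderiv_ext (F G : C -> C) (z l : C) :
  (forall w, F w = G w) -> cderiv F z l -> cderiv G z l.
Proof. intros E. apply cderiv_ext_near. exists 1. split; [lra|]. auto. Qed.

Lemma cderiv_const (c z : C) : cderiv (fun _ => c) z 0.
Proof.
  exists (fun _ => 0%C). repeat split; [apply ccont_const|].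
  exists 1. split; [lra|]. intros; ring.
Qed.

Lemma cderiv_id (z : C) : cderiv (fun w => w) z 1.
Proof.
  exists (fun _ => 1%C). repeat split; [apply ccont_const|].
  exists 1. split; [lra|]. intros; ring.
Qed.

Lemma cderiv_plus (F G : C -> C) (z l m : C) :
  cderiv F z l -> cderiv G z m -> cderiv (fun w => F w + G w)%C z (l + m).
Proof.
  intros [Q [HQ [Hl H]]] [P [HP [Hm K]]].
  exists (fun w => Q w + P w)%C. repeat split.
  - now apply ccont_plus.
  - now rewrite Hl, Hm.
  - eapply cnear_impl; [|exact (cnear_and _ _ _ H K)].
    intros w [E1 E2]. rewrite E1, E2. ring.
Qed.

Lemma cderiv_mult (F G : C -> C) (z l m : C) :
  cderiv F z l -> cderiv G z m ->
  cderiv (fun w => F w * G w)%C z (l * G z + F z * m).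
Proof.
  intros HF HG. pose proof (cderiv_ccont _ _ _ HG) as CG.
  destruct HF as [Q [HQ [Hl H]]]. destruct HG as [P [HP [Hm K]]].
  exists (fun w => Q w * G w + F z * P w)%C. repeat split.
  - apply ccont_plus; apply ccont_mult; auto using ccont_const.
  - now rewrite Hl, Hm.
  - eapply cnear_impl; [|exact (cnear_and _ _ _ H K)].
    intros w [E1 E2]. rewrite E1, E2. ring.
Qed.

Lemma cderiv_scal (c : C) (F : C -> C) (z l : C) :
  cderiv F z l -> cderiv (fun w => c * F w)%C z (c * l).
Proof.
  intros H. replace (c * l)%C with (0 * F z + c * l)%C by ring.
  apply cderiv_mult; [apply cderiv_const | exact H].
Qed.

Lemma cderiv_minus (F G : C -> C) (z l m : C) :
  cderiv F z l -> cderiv G z m -> cderiv (fun w => F w - G w)%C z (l - m).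
Proof.
  intros HF HG. replace (l - m)%C with (l + -1 * m)%C by ring.
  apply cderiv_ext with (fun w => F w + -1 * G w)%C; [intros; ring|].
  apply cderiv_plus; [exact HF|]. now apply cderiv_scal.
Qed.

Lemma cderiv_inv (F : C -> C) (z l : C) :
  cderiv F z l -> F z <> 0%C ->
  cderiv (fun w => / F w)%C z (- l / (F z * F z)).
Proof.
  intros HF Hz. pose proof (cderiv_ccont _ _ _ HF) as CF.
  destruct HF as [Q [HQ [Hl H]]].
  exists (fun w => - Q w * / (F w * F z))%C. repeat split.
  - apply ccont_mult; [now apply ccont_opp|]. apply ccont_inv.
    + apply ccont_mult; [exact CF | apply ccont_const].
    + now apply Cmult_neq_0.
  - now rewrite Hl.
  - eapply cnear_impl;
      [|exact (cnear_and _ _ _ H (ccont_near_ne0 _ _ CF Hz))].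
    intros w [E1 E2].
    assert (E3 : (Q w * (w - z))%C = (F w - F z)%C) by (rewrite E1; ring).
    replace (- Q w * / (F w * F z) * (w - z))%C
      with (- (Q w * (w - z)) * / (F w * F z))%C by ring.
    rewrite E3.
    field. now split.
Qed.

Lemma cderiv_eps (F : C -> C) (z l : C) :
  cderiv F z l <->
  forall eps, 0 < eps ->
    cnear z (fun w => Cmod (F w - F z - l * (w - z)) <= eps * Cmod (w - z)).
Proof.
  split.
  - intros [Q [HQ [Hl H]]] eps Heps.
    eapply cnear_impl; [|exact (cnear_and _ _ _ H (HQ eps Heps))].
    intros w [E Hw]. rewrite E.
    replace (F z + Q w * (w - z) - F z - l * (w - z))%C
      with ((Q w - Q z) * (w - z))%C by (rewrite Hl; ring).
    rewrite Cmod_mult. apply Rmult_le_compat_r; [apply Cmod_ge_0|lra].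
  - intros H.
    (* The difference quotient, completed by the value [l] at [z]; the estimate says exactly that
       this is continuous at [z]. *)
    exists (fun w => if excluded_middle_informative (w = z) then l
                     else ((F w - F z) / (w - z))%C).
    assert (E0 : (if excluded_middle_informative (z = z) then l
                  else ((F z - F z) / (z - z))%C) = l).
    { destruct excluded_middle_informative; congruence. }
    repeat split.
    + intros eps Heps.
      assert (Heps2 : 0 < eps / 2) by lra.
      eapply cnear_impl; [|exact (H _ Heps2)].
      intros w Hw. cbv beta. rewrite E0.
      destruct (excluded_middle_informative (w = z)) as [E|E].
      * replace (l - l)%C with (RtoC 0) by ring. now rewrite Cmod_0.
      * assert (Hne : (w - z)%C <> 0%C).
        { intros K. apply E. now apply Cminus_eq_0. }
        replace ((F w - F z) / (w - z) - l)%C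
          with ((F w - F z - l * (w - z)) / (w - z))%C by now field.
        rewrite Cmod_div by assumption. apply Cmod_gt_0 in Hne.
        apply Rle_lt_trans with (eps / 2); [|lra].
        apply Rmult_le_reg_r with (Cmod (w - z)); [assumption|].
        unfold Rdiv at 1. rewrite Rmult_assoc, Rinv_l by lra. lra.
    + exact E0.
    + exists 1. split; [lra|]. intros w _. cbv beta.
      destruct (excluded_middle_informative (w = z)) as [E|E].
      * rewrite E. ring.
      * field. intros K. apply E. now apply Cminus_eq_0.
Qed.

Lemma is_derive_cderiv (F : C -> C) (z l : C) :
  is_derive (K := C_AbsRing) (V := C_NormedModule) F z l <-> cderiv F z l.
Proof.
  rewrite cderiv_eps. split.
  - intros [_ H] eps Heps. specialize (H z (fun P HP => HP) (mkposreal _ Heps)).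
    destruct H as [d Hd]. exists d. split; [apply cond_pos|].
    intros w Hw. specialize (Hd w Hw).
    rewrite (Cmult_comm l). exact Hd.
  - intros H. split; [apply is_linear_scal_l|].
    intros x Hx eps.
    apply (is_filter_lim_locally_unique (K := C_AbsRing)
      (V := AbsRing_NormedModule C_AbsRing)) in Hx. subst x.
    destruct (H eps (cond_pos eps)) as [d [Hd K]].
    exists (mkposreal d Hd). intros w Hw. specialize (K w Hw).
    rewrite (Cmult_comm l) in K. exact K.
Qed.

(** * Real differentials, Cauchy-Riemann equations and the chain rule along paths *)

Ltac cparts :=
  unfold Re, Im, Cminus, Cdiv, Cinv, Cplus, Copp, Cmult, Cconj, Ci, RtoC;
  cbn [fst snd].

Lemma cderiv_re_differentiable (F : C -> C) (z l : C) :
  cderiv F z l ->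
  differentiable_pt_lim (fun x y => Re (F (x, y))) (Re z) (Im z)
    (Re l) (- Im l).
Proof.
  intros H eps. apply cderiv_eps with (eps := eps / 2) in H;
    [|pose proof (cond_pos eps); lra].
  destruct z as [a b].
  apply (cnear_2d (a, b) (fun w => Rabs (Re (F w) - Re (F (a, b))
    - (Re l * (Re w - a) + - Im l * (Im w - b))) <=
    eps * Rmax (Rabs (Re w - a)) (Rabs (Im w - b)))).
  eapply cnear_impl; [|exact H]. intros w Hw. cbv beta in Hw.
  replace (Re (F w) - Re (F (a, b)) - (Re l * (Re w - a) + - Im l * (Im w - b)))
    with (Re (F w - F (a, b) - l * (w - (a, b)))) by (cparts; ring).
  eapply Rle_trans; [apply re_le_Cmod|].
  eapply Rle_trans; [exact Hw|].
  pose proof (Cmod_le_abs_re_im (w - (a, b))) as K.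
  rewrite re_minus, im_minus in K. simpl in K.
  pose proof (Rmax_l (Rabs (Re w - a)) (Rabs (Im w - b))).
  pose proof (Rmax_r (Rabs (Re w - a)) (Rabs (Im w - b))).
  pose proof (cond_pos eps). nra.
Qed.

Lemma cderiv_im_differentiable (F : C -> C) (z l : C) :
  cderiv F z l ->
  differentiable_pt_lim (fun x y => Im (F (x, y))) (Re z) (Im z)
    (Im l) (Re l).
Proof.
  (* [Im F = Re (- i F)], so the result for real parts applies to [- i F]. *)
  intros H. apply (cderiv_scal (- Ci)) in H.
  apply cderiv_re_differentiable in H.
  replace (Re (- Ci * l)) with (Im l) in H by (cparts; ring).
  replace (- Im (- Ci * l)) with (Re l) in H by (cparts; ring).
  eapply differentiable_pt_lim_ext; [|exact H].
  apply locally_2d_forall. intros; cparts; ring.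
Qed.

(** A real differential with rows [(p, - q)] and [(q, p)] is multiplication by [p + i q], so the two
    real error estimates add up to the complex one. *)
Lemma cauchy_riemann_cderiv (F : C -> C) (z : C) (p q : R) :
  differentiable_pt_lim (fun x y => Re (F (x, y))) (Re z) (Im z) p (- q) ->
  differentiable_pt_lim (fun x y => Im (F (x, y))) (Re z) (Im z) q p ->
  cderiv F z (p, q).
Proof.
  intros H1 H2. apply cderiv_eps. intros eps Heps.
  assert (Heps2 : 0 < eps / 2) by lra.
  specialize (H1 (mkposreal _ Heps2)). specialize (H2 (mkposreal _ Heps2)).
  destruct z as [a b]. simpl in H1, H2.
  apply (cnear_2d (a, b) (fun w => Rabs (Re (F w) - Re (F (a, b))
    - (p * (Re w - a) + - q * (Im w - b))) <=
    eps / 2 * Rmax (Rabs (Re w - a)) (Rabs (Im w - b)))) in H1.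
  apply (cnear_2d (a, b) (fun w => Rabs (Im (F w) - Im (F (a, b))
    - (q * (Re w - a) + p * (Im w - b))) <=
    eps / 2 * Rmax (Rabs (Re w - a)) (Rabs (Im w - b)))) in H2.
  eapply cnear_impl; [|exact (cnear_and _ _ _ H1 H2)].
  intros w [K1 K2]. cbv beta in K1, K2.
  eapply Rle_trans; [apply Cmod_le_abs_re_im|].
  replace (Re (F w - F (a, b) - (p, q) * (w - (a, b))))
    with (Re (F w) - Re (F (a, b)) - (p * (Re w - a) + - q * (Im w - b)))
    by (cparts; ring).
  replace (Im (F w - F (a, b) - (p, q) * (w - (a, b))))
    with (Im (F w) - Im (F (a, b)) - (q * (Re w - a) + p * (Im w - b)))
    by (cparts; ring).
  pose proof (Rmax_Cmod (w - (a, b))%C) as K.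
  change (fst (w - (a, b))%C) with (Re w - a) in K.
  change (snd (w - (a, b))%C) with (Im w - b) in K.
  nra.
Qed.

Lemma C1_differentiable (U : R -> R -> R) (x y : R) :
  locally_2d (fun u v => ex_diff_n U 1 u v) x y ->
  differentiable_pt_lim U x y
    (Derive (fun t => U t y) x) (Derive (fun t => U x t) y).
Proof.
  intros H. apply filterdiff_differentiable_pt_lim.
  eapply filterdiff_ext_lin;
    [apply (is_derive_filterdiff U x y
      (fun u v => Derive (fun t => U t v) u) (Derive (fun t => U x t) y))|].
  - apply locally_2d_locally in H. revert H. apply filter_imp.
    intros [u v] [_ [K _]]. apply Derive_correct. exact K.
  - apply Derive_correct. apply locally_2d_singleton in H. apply H.
  - apply locally_2d_singleton in H.
    destruct H as [_ [_ [_ [[K _] _]]]].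
    apply continuity_2d_pt_filterlim in K. exact K.
  - intros [u v]. reflexivity.
Qed.

Lemma cderiv_re_path (F : C -> C) (x y : R -> R) (t x' y' : R) (l : C) :
  cderiv F (x t, y t) l -> is_derive x t x' -> is_derive y t y' ->
  is_derive (fun s => Re (F (x s, y s))) t (Re (l * (x', y'))).
Proof.
  intros HF Hx Hy. apply cderiv_re_differentiable in HF. simpl in HF.
  apply is_derive_Reals in Hx, Hy. apply is_derive_Reals.
  replace (Re (l * (x', y'))) with (Re l * x' + - Im l * y') by (cparts; ring).
  exact (derivable_pt_lim_comp_2d (fun x y => Re (F (x, y))) x y t _ _ _ _
    HF Hx Hy).
Qed.

Lemma cderiv_im_path (F : C -> C) (x y : R -> R) (t x' y' : R) (l : C) :
  cderiv F (x t, y t) l -> is_derive x t x' -> is_derive y t y' ->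
  is_derive (fun s => Im (F (x s, y s))) t (Im (l * (x', y'))).
Proof.
  intros HF Hx Hy. apply cderiv_im_differentiable in HF. simpl in HF.
  apply is_derive_Reals in Hx, Hy. apply is_derive_Reals.
  replace (Im (l * (x', y'))) with (Im l * x' + Re l * y') by (cparts; ring).
  exact (derivable_pt_lim_comp_2d (fun x y => Im (F (x, y))) x y t _ _ _ _
    HF Hx Hy).
Qed.

(** If no point were a maximum, each point would have a ball on which the values stay below the
    supremum by a fixed margin. Compactness makes the margin uniform, which contradicts the
    supremum. *)
Lemma closed_disk_max (phi : C -> R) (r : R) :
  0 <= r ->
  (forall z, Cmod z <= r -> forall eps, 0 < eps ->
     cnear z (fun w => Rabs (phi w - phi z) < eps)) ->
  exists z0, Cmod z0 <= r /\ forall z, Cmod z <= r -> phi z <= phi z0.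
Proof.
  intros Hr Hc. apply NNPP. intros Hno.
  assert (Hup : forall t, Cmod t <= r -> exists z, Cmod z <= r /\ phi t < phi z).
  { intros t Ht. apply NNPP. intros K. apply Hno. exists t. split; [exact Ht|].
    intros z Hz. apply Rnot_lt_le. intros L. apply K. now exists z. }
  (* [atan] makes the set of values bounded while keeping their order. *)
  destruct (completeness (fun y => exists z, Cmod z <= r /\ y = atan (phi z)))
    as [mu [Hub Hlub]].
  { exists (PI / 2). intros y [z [_ ->]]. left. apply atan_bound. }
  { exists (atan (phi 0%C)). exists 0%C. split; [rewrite Cmod_0; lra|reflexivity]. }
  assert (Hlt : forall t, Cmod t <= r -> atan (phi t) < mu).
  { intros t Ht. destruct (Hup t Ht) as [z [Hz Hz2]].
    apply Rlt_le_trans with (atan (phi z)).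
    - now apply atan_increasing.
    - apply Hub. now exists z. }
  (* One number [d] is both the margin below [mu] and half the radius of the ball. The factor 2 pays
     for the passage from the squares of [compactness_value_2d] to disks. Around a point outside the
     closed disk the ball misses the disk and the claim is vacuous. *)
  assert (Hd : forall t : C, exists d : posreal, forall w : C,
    Cmod (w - t) < 2 * d -> Cmod w <= r -> atan (phi w) <= mu - d).
  { intros t. destruct (Rle_lt_dec (Cmod t) r) as [Ht|Ht].
    - destruct (Hup t Ht) as [z [Hz Hz2]].
      assert (He : 0 < phi z - phi t) by lra.
      destruct (Hc t Ht _ He) as [d [Hd K]].
      pose proof (Hlt z Hz) as Hmu.
      assert (Hm : 0 < Rmin (d / 2) (mu - atan (phi z))).
      { apply Rmin_pos; lra. }
      exists (mkposreal _ Hm). simpl. intros w Hw _.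
      pose proof (Rmin_l (d / 2) (mu - atan (phi z))).
      pose proof (Rmin_r (d / 2) (mu - atan (phi z))).
      assert (Hw2 : Cmod (w - t) < d) by lra.
      apply K in Hw2. apply Rabs_def2 in Hw2.
      assert (atan (phi w) < atan (phi z)) by (apply atan_increasing; lra).
      lra.
    - assert (Hm : 0 < (Cmod t - r) / 2) by lra.
      exists (mkposreal _ Hm). simpl. intros w Hw Hw2. exfalso.
      pose proof (Cmod_triangle_minus t (t - w)) as K.
      replace (t - (t - w))%C with w in K by ring.
      rewrite Cmod_minus_sym in Hw. lra. }
  pose (delta := fun x y =>
    proj1_sig (constructive_indefinite_description _ (Hd (x, y)))).
  destruct (compactness_value_2d (- r) r (- r) r delta) as [d H].
  assert (Hfin : mu <= mu - d).
  { apply Hlub. intros y [w [Hw ->]].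
    pose proof (re_le_Cmod w) as Kr. pose proof (im_le_Cmod w) as Ki.
    assert (Hx : - r <= Re w <= r) by (apply Rabs_le_between; lra).
    assert (Hy : - r <= Im w <= r) by (apply Rabs_le_between; lra).
    specialize (H _ _ Hx Hy). apply NNPP in H.
    destruct H as [u [v [_ [_ [H1 [H2 H3]]]]]].
    unfold delta in H1, H2, H3.
    destruct (constructive_indefinite_description _ (Hd (u, v))) as [e He].
    simpl in H1, H2, H3.
    apply Rle_trans with (mu - e); [|lra].
    apply He; [|exact Hw].
    eapply Rle_lt_trans; [apply Cmod_le_abs_re_im|].
    rewrite re_minus, im_minus. simpl. lra. }
  pose proof (cond_pos d). lra.
Qed.

(** * The mean value property *)

Definition circ (z0 : C) (r t : R) : C :=
  (Re z0 + r * cos t, Im z0 + r * sin t).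

Lemma Cmod_circ (z0 : C) (r t : R) : 0 <= r -> Cmod (circ z0 r t - z0) = r.
Proof.
  intros Hr. unfold Cmod, circ. cparts.
  replace (_ ^ 2 + _ ^ 2) with (r ^ 2).
  - now apply sqrt_pow2.
  - pose proof (sin2_cos2 t) as H. unfold Rsqr in H.
    transitivity (r ^ 2 * (sin t * sin t + cos t * cos t)); [rewrite H|]; ring.
Qed.

(** Continuity of the derivative is built in, since differentiation under the integral sign requires
    it. The set [A] is arbitrary so that punctured disks are covered. *)
Definition holo (A : C -> Prop) (F : C -> C) : Prop :=
  exists F1, forall z, A z -> cderiv F z (F1 z) /\ ccont F1 z.

Lemma holo_subset (A B : C -> Prop) (F : C -> C) :
  (forall z, A z -> B z) -> holo B F -> holo A F.
Proof. intros H [F1 K]. exists F1. auto. Qed.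

Lemma holo_ccont (A : C -> Prop) (F : C -> C) (z : C) :
  holo A F -> A z -> ccont F z.
Proof. intros [F1 K] Hz. destruct (K z Hz). now apply cderiv_ccont with (F1 z). Qed.

Lemma holo_const (A : C -> Prop) (c : C) : holo A (fun _ => c).
Proof.
  exists (fun _ => 0%C). intros z _. split; [apply cderiv_const|apply ccont_const].
Qed.

Lemma holo_id (A : C -> Prop) : holo A (fun z => z).
Proof.
  exists (fun _ => 1%C). intros z _. split; [apply cderiv_id|apply ccont_const].
Qed.

Lemma holo_plus (A : C -> Prop) (F G : C -> C) :
  holo A F -> holo A G -> holo A (fun z => F z + G z)%C.
Proof.
  intros [F1 HF] [G1 HG]. exists (fun z => F1 z + G1 z)%C. intros z Hz.
  destruct (HF z Hz), (HG z Hz). split.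
  - now apply cderiv_plus.
  - now apply ccont_plus.
Qed.

Lemma holo_mult (A : C -> Prop) (F G : C -> C) :
  holo A F -> holo A G -> holo A (fun z => F z * G z)%C.
Proof.
  intros HF HG. pose proof HF as [F1 HF1]. pose proof HG as [G1 HG1].
  exists (fun z => F1 z * G z + F z * G1 z)%C. intros z Hz.
  destruct (HF1 z Hz), (HG1 z Hz). split.
  - now apply cderiv_mult.
  - apply ccont_plus; apply ccont_mult; try assumption;
      now apply holo_ccont with A.
Qed.

Lemma holo_minus (A : C -> Prop) (F G : C -> C) :
  holo A F -> holo A G -> holo A (fun z => F z - G z)%C.
Proof.
  intros [F1 HF] [G1 HG]. exists (fun z => F1 z - G1 z)%C. intros z Hz.
  destruct (HF z Hz), (HG z Hz). split.
  - now apply cderiv_minus.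
  - now apply ccont_minus.
Qed.

Lemma holo_inv (A : C -> Prop) (F : C -> C) :
  holo A F -> (forall z, A z -> F z <> 0%C) -> holo A (fun z => / F z)%C.
Proof.
  intros HF Hne. pose proof HF as [F1 HF1].
  exists (fun z => - F1 z / (F z * F z))%C. intros z Hz.
  destruct (HF1 z Hz). split.
  - now apply cderiv_inv; auto.
  - apply ccont_mult; [now apply ccont_opp|]. apply ccont_inv.
    + apply ccont_mult; now apply holo_ccont with A.
    + apply Cmult_neq_0; auto.
Qed.

Lemma holo_div (A : C -> Prop) (F G : C -> C) :
  holo A F -> holo A G -> (forall z, A z -> G z <> 0%C) ->
  holo A (fun z => F z / G z)%C.
Proof. intros HF HG H. apply holo_mult; [exact HF|]. now apply holo_inv. Qed.

Lemma holo_ext_near (A : C -> Prop) (F G : C -> C) :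
  (forall z, A z -> cnear z (fun w => F w = G w)) -> holo A F -> holo A G.
Proof.
  intros E [F1 HF]. exists F1. intros z Hz. destruct (HF z Hz). split; [|easy].
  apply cderiv_ext_near with F; auto.
Qed.

(* The mean of [G] over the circle of radius [r] does not depend on [r]: its
   [r]-derivative is the integral of [G'(z0 + r e^{it}) e^{it}], that is, of
   the [t]-derivative of [G(z0 + r e^{it}) / (i r)]. *)
Lemma circle_mean (G : C -> C) (z0 : C) (r0 : R) :
  holo (fun z => 0 < Cmod (z - z0) < r0) G -> ccont G z0 ->
  forall r, 0 < r < r0 ->
  is_RInt (fun t => Re (G (circ z0 r t))) 0 (2 * PI) (2 * PI * Re (G z0)).
Proof.
  intros [G1 HG] Hc r Hr.
  pose proof PI_RGT_0 as Hpi.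
  assert (Hin : forall u t, 0 < u < r0 -> 0 < Cmod (circ z0 u t - z0) < r0).
  { intros u t Hu. rewrite Cmod_circ; lra. }
  assert (Hdu : forall u t, 0 < u < r0 ->
    is_derive (fun u => Re (G (circ z0 u t))) u
      (Re (G1 (circ z0 u t) * (cos t, sin t)))).
  { intros u t Hu. destruct (HG _ (Hin u t Hu)) as [H _].
    apply (cderiv_re_path G (fun u => Re z0 + u * cos t)
      (fun u => Im z0 + u * sin t)); [exact H| |]; auto_derive; trivial; ring. }
  assert (Hdt : forall u t, 0 < u < r0 ->
    is_derive (fun t => Re (G (circ z0 u t))) t
      (Re (G1 (circ z0 u t) * (- u * sin t, u * cos t)))).
  { intros u t Hu. destruct (HG _ (Hin u t Hu)) as [H _].
    apply (cderiv_re_path G (fun t => Re z0 + u * cos t)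
      (fun t => Im z0 + u * sin t)); [exact H| |]; auto_derive; trivial; ring. }
  assert (Hdi : forall u t, 0 < u < r0 ->
    is_derive (fun t => / u * Im (G (circ z0 u t))) t
      (Re (G1 (circ z0 u t) * (cos t, sin t)))).
  { intros u t Hu. destruct (HG _ (Hin u t Hu)) as [H _].
    replace (Re (G1 (circ z0 u t) * (cos t, sin t)))
      with (/ u * Im (G1 (circ z0 u t) * (- u * sin t, u * cos t)))
      by (cparts; field; lra).
    apply is_derive_scal.
    apply (cderiv_im_path G (fun t => Re z0 + u * cos t)
      (fun t => Im z0 + u * sin t)); [exact H| |]; auto_derive; trivial; ring. }
  assert (Hcirc : forall u t, ccont (fun w => circ z0 (Re w) (Im w)) (u, t) /\
                  ccont (fun w => (cos (Im w), sin (Im w))) (u, t)).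
  { intros u t.
    assert (Hcos : continuity_2d_pt (fun _ y => cos y) u t).
    { apply (continuity_1d_2d_pt_comp cos (fun _ y => y));
        [apply continuity_cos | apply continuity_2d_pt_id2]. }
    assert (Hsin : continuity_2d_pt (fun _ y => sin y) u t).
    { apply (continuity_1d_2d_pt_comp sin (fun _ y => y));
        [apply continuity_sin | apply continuity_2d_pt_id2]. }
    split; apply ccont_2d; split; simpl; try assumption;
      (apply continuity_2d_pt_plus; [apply continuity_2d_pt_const|]);
      apply continuity_2d_pt_mult; auto using continuity_2d_pt_id1. }
  assert (Hc2 : forall u t, 0 < u < r0 -> continuity_2d_pt
    (fun u t => Re (G1 (circ z0 u t) * (cos t, sin t))) u t).
  { intros u t Hu.
    assert (K : ccont (fun w => G1 (circ z0 (Re w) (Im w))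
                           * (cos (Im w), sin (Im w)))%C (u, t)).
    { apply ccont_mult; [|apply Hcirc].
      apply (ccont_comp (fun w => circ z0 (Re w) (Im w)) G1); [apply Hcirc|].
      apply HG. now apply Hin. }
    apply ccont_2d in K. exact (proj1 K). }
  assert (Hex : forall u, 0 < u < r0 ->
    ex_RInt (fun t => Re (G (circ z0 u t))) 0 (2 * PI)).
  { intros u Hu. apply (ex_RInt_continuous (V := R_CompleteNormedModule)).
    intros t _. apply (ex_derive_continuous (V := R_NormedModule)).
    eexists. now apply Hdt. }
  assert (Hloc : forall u, 0 < u < r0 -> locally u (fun v => 0 < v < r0)).
  { intros u Hu.
    apply (open_and (fun v => 0 < v) (fun v => v < r0));
      [apply open_gt | apply open_lt | exact Hu]. }
  pose (A := fun u => RInt (fun t => Re (G (circ z0 u t))) 0 (2 * PI)).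
  assert (HA : forall u, 0 < u < r0 -> is_derive A u 0).
  { intros u Hu.
    replace 0 with (RInt (fun t => Derive (fun u => Re (G (circ z0 u t))) u)
                      0 (2 * PI)).
    - apply (is_derive_RInt_param (fun u t => Re (G (circ z0 u t)))).
      + generalize (Hloc u Hu). apply filter_imp. intros v Hv t _.
        eexists. now apply Hdu.
      + intros t _. eapply continuity_2d_pt_ext_loc; [|exact (Hc2 u t Hu)].
        destruct (Hloc u Hu) as [d Hd]. exists d. intros v s Hv _.
        symmetry. apply is_derive_unique. apply Hdu. now apply Hd.
      + generalize (Hloc u Hu). apply filter_imp. intros v Hv. now apply Hex.
    - rewrite (RInt_ext _ (fun t => Re (G1 (circ z0 u t) * (cos t, sin t))))
        by (intros t _; apply is_derive_unique; now apply Hdu).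
      apply (is_RInt_unique (V := R_CompleteNormedModule)).
      replace 0 with
        (minus (/ u * Im (G (circ z0 u (2 * PI))))
           (/ u * Im (G (circ z0 u 0)))) at 2.
      + apply (is_RInt_derive (V := R_CompleteNormedModule)
          (fun t => / u * Im (G (circ z0 u t)))).
        * intros t _. now apply Hdi.
        * intros t _.
          pose proof (Hc2 u t Hu) as K. apply continuity_2d_pt_filterlim in K.
          apply (filterlim_comp R (R * R) R (fun t => (u, t))
            (fun z => Re (G1 (circ z0 (fst z) (snd z)) *
                          (cos (snd z), sin (snd z)))) _ _ _) with (2 := K).
          intros P [d Hd]. exists d. intros s Hs. apply Hd.
          split; [apply ball_center | exact Hs].
      (* The circle closes up, so the two endpoint values of the primitive cancel. *)
      + unfold circ. rewrite cos_2PI, sin_2PI, cos_0, sin_0.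
        unfold minus, plus, opp; simpl. ring. }
  assert (Hconst : forall u v, 0 < u -> u < v -> v < r0 -> A u = A v).
  { intros u v H1 H2 H3. apply (eq_is_derive A u v); [|exact H2].
    intros t Ht. apply HA. lra. }
  replace (2 * PI * Re (G z0)) with (A r).
  { apply (RInt_correct (V := R_CompleteNormedModule)). now apply Hex. }
  (* The constant value of [A] is identified on a small circle of radius [s], where continuity at
     the centre keeps [G] within [eps / (4 * PI)] of [G z0]. *)
  apply cond_eq. intros eps Heps.
  assert (He : 0 < eps / (4 * PI)) by (apply Rdiv_lt_0_compat; lra).
  destruct (Hc _ He) as [d [Hd K]].
  pose (s := Rmin (r / 2) (d / 2)).
  assert (Hs : 0 < s) by (apply Rmin_pos; lra).
  pose proof (Rmin_l (r / 2) (d / 2)) as Hs1. fold s in Hs1.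
  pose proof (Rmin_r (r / 2) (d / 2)) as Hs2. fold s in Hs2.
  rewrite <- (Hconst s r) by lra.
  assert (E : A s - 2 * PI * Re (G z0) =
    RInt (fun t => Re (G (circ z0 s t)) - Re (G z0)) 0 (2 * PI)).
  { symmetry. apply (is_RInt_unique (V := R_CompleteNormedModule)).
    replace (2 * PI * Re (G z0)) with (scal (2 * PI - 0) (Re (G z0)))
      by (unfold scal; simpl; unfold mult; simpl; ring).
    apply (is_RInt_minus (V := R_NormedModule));
      [|apply (is_RInt_const (V := R_NormedModule))].
    apply (RInt_correct (V := R_CompleteNormedModule)). apply Hex; lra. }
  rewrite E.
  apply Rle_lt_trans with ((2 * PI - 0) * (eps / (4 * PI))).
  - apply abs_RInt_le_const; [lra| |].
    + apply (ex_RInt_minus (V := R_NormedModule));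
        [apply Hex; lra | apply ex_RInt_const].
    + intros t _. rewrite <- re_minus.
      eapply Rle_trans; [apply re_le_Cmod|]. left. apply K.
      rewrite Cmod_circ; lra.
  - replace ((2 * PI - 0) * (eps / (4 * PI))) with (eps / 2) by (field; lra). lra.
Qed.

(** * The maximum principle and the Schwarz-Pick lemma *)

Lemma unit_rotation (a : C) :
  exists c, Cmod c = 1 /\ (c * a)%C = RtoC (Cmod a).
Proof.
  destruct (excluded_middle_informative (a = 0%C)) as [->|H].
  - exists 1%C. split; [apply Cmod_1|]. rewrite Cmod_0. ring.
  - pose proof (proj1 (Cmod_gt_0 a) H) as Hp.
    assert (Hne : RtoC (Cmod a) <> 0%C).
    { intros E. injection E. lra. }
    exists (Cconj a / Cmod a)%C. split.
    + rewrite Cmod_div by exact Hne. rewrite Cmod_conj, Cmod_R, Rabs_pos_eq by lra.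
      field. lra.
    + replace (Cconj a / Cmod a * a)%C with (a * Cconj a / Cmod a)%C
        by now field.
      rewrite <- Cmod2_conj. rewrite <- RtoC_div by lra. f_equal. field. lra.
Qed.

(* Subharmonicity of [|q| + eps |z|^2] in the strict form: at an interior
   maximum [z0] the mean of the holomorphic majorant
   [c q(z) + 2 eps conj(z0) (z - z0)] over a small circle would be too small. *)
Lemma max_modulus (q : C -> C) (r B : R) :
  0 < r ->
  holo (fun z => Cmod z < r /\ z <> 0%C) q ->
  (forall z, Cmod z <= r -> ccont q z) ->
  (forall z, Cmod z = r -> Cmod (q z) <= B) ->
  forall z, Cmod z <= r -> Cmod (q z) <= B.
Proof.
  intros Hr Hq Hc HB z Hz. apply le_epsilon. intros e He.
  pose (eps := e / r ^ 2).
  assert (Hr2 : 0 < r ^ 2) by (apply pow_lt; lra).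
  assert (Heps : 0 < eps) by (apply Rdiv_lt_0_compat; lra).
  pose (phi := fun w => Cmod (q w) + eps * Cmod w ^ 2).
  destruct (closed_disk_max phi r) as [z0 [Hz0 Hmax]]; [lra| |].
  { intros w Hw d Hd.
    assert (H1 : 0 < d / 2) by lra.
    assert (H2 : 0 < d / (2 * eps)) by (apply Rdiv_lt_0_compat; lra).
    assert (Hsq : ccont (fun v => v * Cconj v)%C w).
    { apply ccont_mult; [apply ccont_id|]. apply ccont_conj, ccont_id. }
    eapply cnear_impl; [|exact (cnear_and _ _ _ (Hc w Hw _ H1) (Hsq _ H2))].
    intros v [K1 K2]. cbv beta in K1, K2. unfold phi.
    rewrite <- !Cmod2_conj, <- RtoC_minus, Cmod_R in K2.
    assert (K3 : Rabs (Cmod (q v) - Cmod (q w)) < d / 2).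
    { eapply Rle_lt_trans; [|exact K1]. apply Rabs_le. split.
      - pose proof (Cmod_triangle_minus (q w) (q v)) as K.
        rewrite Cmod_minus_sym in K. lra.
      - apply Cmod_triangle_minus. }
    replace (Cmod (q v) + eps * Cmod v ^ 2 - (Cmod (q w) + eps * Cmod w ^ 2))
      with ((Cmod (q v) - Cmod (q w)) + eps * (Cmod v ^ 2 - Cmod w ^ 2)) by ring.
    eapply Rle_lt_trans; [apply Rabs_triang|].
    rewrite Rabs_mult, (Rabs_pos_eq eps) by lra.
    assert (eps * Rabs (Cmod v ^ 2 - Cmod w ^ 2) < d / 2).
    { replace (d / 2) with (eps * (d / (2 * eps))) by (field; lra).
      now apply Rmult_lt_compat_l. }
    lra. }
  destruct (Rle_lt_or_eq_dec _ _ Hz0) as [Hlt|Heq].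
  - exfalso.
    (* The punctured disk about [z0] must avoid the origin, where [q] is only continuous; if
       [z0 = 0], the puncture already removes it. *)
    assert (Hr0 : exists r0, 0 < r0 /\ forall w, 0 < Cmod (w - z0) < r0 ->
      Cmod w < r /\ w <> 0%C).
    { destruct (excluded_middle_informative (z0 = 0%C)) as [E|E].
      - exists r. split; [exact Hr|]. intros w. rewrite E.
        replace (w - 0)%C with w by ring. intros [K1 K2]. split; [exact K2|].
        now apply Cmod_gt_0.
      - apply Cmod_gt_0 in E. exists (Rmin (r - Cmod z0) (Cmod z0)).
        split; [apply Rmin_pos; lra|]. intros w [_ K].
        pose proof (Rmin_l (r - Cmod z0) (Cmod z0)).
        pose proof (Rmin_r (r - Cmod z0) (Cmod z0)).
        split.
        + replace w with ((w - z0) + z0)%C by ring.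
          eapply Rle_lt_trans; [apply Cmod_triangle|]. lra.
        + intros ->. replace (0 - z0)%C with (- z0)%C in K by ring.
          rewrite Cmod_opp in K. lra. }
    destruct Hr0 as [r0 [Hr0 Hin]].
    destruct (unit_rotation (q z0)) as [c [Hc1 Hcq]].
    pose (Q := fun w => (c * q w + 2 * eps * Cconj z0 * (w - z0))%C).
    assert (HQ : holo (fun w => 0 < Cmod (w - z0) < r0) Q).
    { apply holo_plus; apply holo_mult; try apply holo_const.
      - eapply holo_subset; [|exact Hq]. exact Hin.
      - apply holo_minus; [apply holo_id | apply holo_const]. }
    assert (HQc : ccont Q z0).
    { apply ccont_plus; apply ccont_mult; try apply ccont_const.
      - now apply Hc.
      - apply ccont_minus; [apply ccont_id | apply ccont_const]. }
    pose (s := r0 / 2).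
    assert (Hs : 0 < s < r0) by (unfold s; lra).
    pose proof (circle_mean Q z0 r0 HQ HQc s Hs) as Hint.
    assert (HQ0 : Re (Q z0) = Cmod (q z0)).
    { unfold Q. replace (c * q z0 + 2 * eps * Cconj z0 * (z0 - z0))%C
        with (c * q z0)%C by ring. rewrite Hcq. apply re_RtoC. }
    assert (Hub : forall t, Re (Q (circ z0 s t)) <= Cmod (q z0) - eps * s ^ 2).
    { intros t. set (w := circ z0 s t).
      assert (Hws : Cmod (w - z0) = s) by (apply Cmod_circ; lra).
      assert (Hw : Cmod w <= r).
      { left. apply Hin. rewrite Hws. exact Hs. }
      specialize (Hmax w Hw). unfold phi in Hmax.
      (* The expansion of [|z0 + (w - z0)|^2]: the linear term absorbs the change of [eps |w|^2],
         and the quadratic term leaves the gain [eps * s ^ 2]. *)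
      assert (E : Re (2 * eps * Cconj z0 * (w - z0)) =
        eps * (Cmod w ^ 2 - Cmod z0 ^ 2 - s ^ 2)).
      { rewrite <- Hws, !Cmod2_alt. cparts. ring. }
      unfold Q. rewrite re_plus, E.
      assert (K : Re (c * q w) <= Cmod (q w)).
      { pose proof (re_le_Cmod (c * q w)) as K. rewrite Cmod_mult, Hc1 in K.
        pose proof (Rle_abs (Re (c * q w))). lra. }
      lra. }
    pose proof PI_RGT_0 as Hpi.
    pose proof (is_RInt_le _ _ _ _ _ _ (Rlt_le 0 (2 * PI) ltac:(lra)) Hint
      (is_RInt_const (V := R_NormedModule) 0 (2 * PI) (Cmod (q z0) - eps * s ^ 2))
      (fun t _ => Hub t)) as K.
    change (2 * PI * Re (Q z0) <= (2 * PI - 0) * (Cmod (q z0) - eps * s ^ 2)) in K.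
    rewrite HQ0 in K.
    assert (0 < s * s) by nra. assert (0 < eps * (s * s)) by nra.
    assert (0 < PI * (eps * (s * s))) by nra. nra.
  (* At a boundary maximum the added term is [eps * r ^ 2 = e], the slack granted at the start. *)
  - specialize (Hmax z Hz). unfold phi in Hmax. rewrite Heq in Hmax.
    specialize (HB z0 Heq).
    assert (0 <= eps * Cmod z ^ 2).
    { apply Rmult_le_pos; [lra|]. apply pow2_ge_0. }
    replace (eps * r ^ 2) with e in Hmax by (unfold eps; field; lra).
    lra.
Qed.

(** For [b] and [w] in the closed unit disk the right side is non-negative, so the Blaschke factor
    [(w - b) / (1 - Cconj b * w)] has modulus at most 1 wherever its denominator does not vanish. *)
Lemma blaschke_sqr (b w : C) :
  Cmod (1 - Cconj b * w) ^ 2 - Cmod (w - b) ^ 2 =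
  (1 - Cmod b ^ 2) * (1 - Cmod w ^ 2).
Proof. rewrite !Cmod2_alt. cparts. ring. Qed.

Lemma schwarz (psi : C -> C) :
  holo unit_disk psi -> psi 0%C = 0%C ->
  (forall z, unit_disk z -> Cmod (psi z) <= 1) ->
  forall z, unit_disk z -> Cmod (psi z) <= Cmod z.
Proof.
  intros Hpsi H0 Hb z Hz. apply Rnot_lt_le. intros Hlt.
  pose proof (Hb z Hz) as Hbz. rewrite unit_disk_Cmod in Hz.
  pose proof (Cmod_ge_0 z) as Hz0.
  pose proof Hpsi as [psi1 Hpsi1].
  pose proof unit_disk_0 as HD0.
  destruct (Hpsi1 0%C HD0) as [[Q [HQ [HQ0 Hnear]]] _].
  (* The quotient [psi w / w], with Caratheodory's factor supplying both its value at 0 and its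
     continuity there. *)
  pose (q := fun w : C => if excluded_middle_informative (w = 0%C) then Q 0%C
                      else (psi w / w)%C).
  assert (Hqne : forall w : C, w <> 0%C -> q w = (psi w / w)%C).
  { intros w Hw. unfold q.
    destruct (excluded_middle_informative (w = 0%C)); easy. }
  assert (Hqn : forall w : C, w <> 0%C -> cnear w (fun v => (psi v / v)%C = q v)).
  { intros w Hw. eapply cnear_impl; [|exact (cnear_neq _ _ Hw)].
    intros v Hv. symmetry. now apply Hqne. }
  assert (Hqh : holo (fun w : C => Cmod w < 1 /\ w <> 0%C) q).
  { apply holo_ext_near with (fun w : C => psi w / w)%C.
    - intros w [_ Hw]. now apply Hqn.
    - apply holo_div; [|apply holo_id|tauto].
      eapply holo_subset; [|exact Hpsi]. intros w [Hw _]. now apply unit_disk_Cmod. }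
  assert (Hqc : forall w, Cmod w < 1 -> ccont q w).
  { intros w Hw. destruct (excluded_middle_informative (w = 0%C)) as [->|Hne].
    - apply ccont_ext_near with Q; [|exact HQ].
      eapply cnear_impl; [|exact Hnear]. intros v Ev. cbv beta in Ev.
      unfold q. destruct (excluded_middle_informative (v = 0%C)) as [->|Hv];
        [reflexivity|]. rewrite Ev, H0. field. exact Hv.
    - apply holo_ccont with (fun w : C => Cmod w < 1 /\ w <> 0%C); auto. }
  pose (p := Cmod (psi z)). fold p in Hlt, Hbz.
  assert (Hp : 0 < p) by lra.
  (* One radius replaces the limit [r -> 1]. The maximum principle gives [p * r <= Cmod z], whereas
     the midpoint [r] of [Cmod z / p] and 1 satisfies [p * r = (p + Cmod z) / 2 > Cmod z]. *)
  pose (r := (1 + Cmod z / p) / 2).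
  assert (Hzp : Cmod z <= Cmod z / p < 1).
  { split.
    - apply Rmult_le_reg_r with p; [lra|]. unfold Rdiv.
      rewrite Rmult_assoc, Rinv_l by lra. nra.
    - apply Rmult_lt_reg_r with p; [lra|]. unfold Rdiv.
      rewrite Rmult_assoc, Rinv_l by lra. lra. }
  assert (Hr : Cmod z < r < 1) by (unfold r; lra).
  assert (Hrp : 0 < r) by lra.
  assert (Hrb : Cmod (q z) <= / r).
  { apply (max_modulus q r (/ r)); [lra| | | |lra].
    - eapply holo_subset; [|exact Hqh]. intros w [K1 K2]. split; [lra|exact K2].
    - intros w Hw. apply Hqc. lra.
    - intros w Hw. assert (Hw0 : w <> 0%C) by (apply Cmod_gt_0; lra).
      rewrite Hqne, Cmod_div, Hw by exact Hw0.
      unfold Rdiv. rewrite <- (Rmult_1_l (/ r)) at 2.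
      apply Rmult_le_compat_r; [left; now apply Rinv_0_lt_compat|].
      apply Hb, unit_disk_Cmod. lra. }
  destruct (Rle_lt_or_eq_dec _ _ Hz0) as [Hzpos|Hzz].
  - assert (Hzne : z <> 0%C) by now apply Cmod_gt_0.
    rewrite Hqne, Cmod_div in Hrb by exact Hzne. fold p in Hrb.
    assert (K : p * r <= Cmod z).
    { apply Rmult_le_reg_r with (/ Cmod z * / r).
      - apply Rmult_lt_0_compat; now apply Rinv_0_lt_compat.
      - replace (p * r * (/ Cmod z * / r)) with (p / Cmod z) by (field; lra).
        replace (Cmod z * (/ Cmod z * / r)) with (/ r) by (field; lra). exact Hrb. }
    unfold r in K. replace (p * ((1 + Cmod z / p) / 2))
      with ((p + Cmod z) / 2) in K by (field; lra). lra.
  - symmetry in Hzz. apply Cmod_eq_0 in Hzz. unfold p in Hp.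
    rewrite Hzz, H0, Cmod_0 in Hp. lra.
Qed.

(** The Schwarz lemma for [p] followed by the Blaschke factor that sends [p 0] to 0; the bound
    [s < 1] keeps the denominator of that factor from vanishing. *)
Lemma schwarz_pick_strict (p : C -> C) (s : R) :
  s < 1 -> holo unit_disk p ->
  (forall z, unit_disk z -> Cmod (p z) <= s) ->
  forall z, unit_disk z ->
    Cmod (p z - p 0%C) <= Cmod z * Cmod (1 - Cconj (p 0%C) * p z).
Proof.
  intros Hs Hp Hb z Hz. set (b := p 0%C).
  pose proof unit_disk_0 as HD0.
  pose proof (Hb 0%C HD0) as Hb0. fold b in Hb0.
  pose proof (Cmod_ge_0 b) as Hbp.
  assert (Hden : forall w, unit_disk w -> (1 - Cconj b * p w)%C <> 0%C).
  { intros w Hw E. pose proof (Cmod_triangle_minus 1 (Cconj b * p w)) as K.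
    rewrite E, Cmod_0, Cmod_1, Cmod_mult, Cmod_conj in K.
    pose proof (Hb w Hw). pose proof (Cmod_ge_0 (p w)). nra. }
  pose (psi := fun w => ((p w - b) / (1 - Cconj b * p w))%C).
  assert (H : Cmod (psi z) <= Cmod z).
  { apply schwarz; [| | |exact Hz].
    - apply holo_div.
      + apply holo_minus; [exact Hp | apply holo_const].
      + apply holo_minus; [apply holo_const|].
        apply holo_mult; [apply holo_const | exact Hp].
      + exact Hden.
    - unfold psi. replace (p 0%C - b)%C with (RtoC 0) by (unfold b; ring).
      unfold Cdiv. ring.
    - intros w Hw. unfold psi. rewrite Cmod_div by now apply Hden.
      pose proof (proj1 (Cmod_gt_0 _) (Hden w Hw)) as Hpos.
      apply Rmult_le_reg_r with (Cmod (1 - Cconj b * p w)); [exact Hpos|].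
      unfold Rdiv. rewrite Rmult_assoc, Rinv_l, Rmult_1_r, Rmult_1_l by lra.
      apply Rsqr_incr_0_var; [|lra]. unfold Rsqr.
      pose proof (blaschke_sqr b (p w)) as E.
      pose proof (Hb w Hw). pose proof (Cmod_ge_0 (p w)).
      assert (0 <= (1 - Cmod b ^ 2) * (1 - Cmod (p w) ^ 2)).
      { apply Rmult_le_pos; nra. }
      nra. }
  unfold psi in H. rewrite Cmod_div in H by now apply Hden.
  pose proof (proj1 (Cmod_gt_0 _) (Hden z Hz)) as Hpos.
  apply Rmult_le_compat_r with (r := Cmod (1 - Cconj b * p z)) in H; [|lra].
  unfold Rdiv in H. rewrite Rmult_assoc, Rinv_l, Rmult_1_r in H by lra. exact H.
Qed.

Lemma schwarz_pick (p : C -> C) :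
  holo unit_disk p ->
  (forall z, unit_disk z -> Cmod (p z) <= 1) ->
  forall z, unit_disk z ->
    Cmod (p z - p 0%C) <= Cmod z * Cmod (1 - Cconj (p 0%C) * p z).
Proof.
  intros Hp Hb z Hz.
  pose proof unit_disk_0 as HD0.
  pose proof (proj1 (unit_disk_Cmod z) Hz) as Hz1.
  pose proof (Cmod_ge_0 z) as Hz0.
  pose proof (Hb z Hz) as Hbz. pose proof (Hb _ HD0) as Hb0.
  pose proof (Cmod_ge_0 (p z)) as Hpz. pose proof (Cmod_ge_0 (p 0%C)) as Hp0.
  set (a := Cmod (p z - p 0%C)).
  set (b := Cmod z * Cmod (1 - Cconj (p 0%C) * p z)).
  apply Rnot_lt_le. intros Hlt.
  assert (Hb' : 0 <= b) by (apply Rmult_le_pos; apply Cmod_ge_0).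
  (* Scaling will cost [(1 - d) * a <= b + 2 * d], that is [a - b <= d * (a + 2)]; this [d] makes
     the right side [(a - b) / 2]. *)
  pose (d := (a - b) / (2 * (a + 2))).
  assert (Hd : 0 < d) by (apply Rdiv_lt_0_compat; lra).
  assert (Hda : d * (2 * (a + 2)) = a - b) by (unfold d; field; lra).
  assert (Hd1 : d < 1) by nra.
  assert (K : Cmod ((1 - d)%R * p z - (1 - d)%R * p 0%C) <=
    Cmod z * Cmod (1 - Cconj ((1 - d)%R * p 0%C) * ((1 - d)%R * p z))).
  { apply (schwarz_pick_strict (fun w => (1 - d)%R * p w)%C (1 - d)); [lra| |
      |exact Hz].
    - apply holo_mult; [apply holo_const | exact Hp].
    - intros w Hw. rewrite Cmod_mult, Cmod_R, Rabs_pos_eq by lra.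
      pose proof (Hb w Hw). pose proof (Cmod_ge_0 (p w)). nra. }
  replace ((1 - d)%R * p z - (1 - d)%R * p 0%C)%C
    with ((1 - d)%R * (p z - p 0%C))%C in K by ring.
  rewrite Cmod_mult, Cmod_R, Rabs_pos_eq in K by lra. fold a in K.
  assert (E : (1 - Cconj ((1 - d)%R * p 0%C) * ((1 - d)%R * p z))%C =
    ((1 - Cconj (p 0%C) * p z) + (1 - (1 - d) * (1 - d))%R * (Cconj (p 0%C) * p z))%C).
  { apply injective_projections; cparts; ring. }
  rewrite E in K.
  pose proof (Cmod_triangle (1 - Cconj (p 0%C) * p z)
    ((1 - (1 - d) * (1 - d))%R * (Cconj (p 0%C) * p z))) as T.
  rewrite !Cmod_mult, Cmod_conj, Cmod_R, Rabs_pos_eq in T by nra.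
  assert (Hpp : Cmod (p 0%C) * Cmod (p z) <= 1) by nra.
  set (X := Cmod (p 0%C) * Cmod (p z)) in *.
  assert (HX : 0 <= X) by (apply Rmult_le_pos; lra).
  assert (T2 : (1 - (1 - d) * (1 - d)) * X <= 2 * d) by nra.
  set (Y := Cmod (1 - Cconj (p 0%C) * p z)) in *.
  assert (T3 : (1 - d) * a <= b + 2 * d).
  { eapply Rle_trans; [exact K|]. unfold b.
    apply Rle_trans with (Cmod z * (Y + 2 * d)); [|nra].
    apply Rmult_le_compat_l; lra. }
  nra.
Qed.

(** Here [beta] is the positive number [p 0] and [x + i y] is [p z]. The last hypothesis describes a
    pseudo-hyperbolic disk about [beta], whose leftmost point [(beta - r) / (1 - beta * r)]
    increases with [beta]; at [beta = 1 / L] it equals [(1 - L * r) / (L - r)]. *)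
Lemma schwarz_pick_re (beta L r x y : R) :
  1 <= L -> 0 <= r < 1 -> r < L -> 1 <= beta * L -> beta <= 1 ->
  (x - beta) ^ 2 + y ^ 2 <= r ^ 2 * ((1 - beta * x) ^ 2 + (beta * y) ^ 2) ->
  1 - L * r <= x * (L - r).
Proof.
  intros HL Hr HrL Hb Hb1 H.
  assert (Hb0 : 0 < beta) by nra.
  assert (Hbr : beta * r < 1) by nra.
  assert (Hbr0 : 0 <= beta * r) by nra.
  (* At [y = 0] the inequality is a difference of squares; its factors vanish at the two ends of the
     real diameter of the disk. *)
  assert (Hprod : ((1 - beta * r) * x - (beta - r)) *
    ((1 + beta * r) * x - (beta + r)) <= 0).
  { assert (0 <= (1 - (beta * r) ^ 2) * y ^ 2).
    { apply Rmult_le_pos; [nra | apply pow2_ge_0]. }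
    nra. }
  assert (H1 : beta - r <= (1 - beta * r) * x).
  { apply Rnot_lt_le. intros K.
    assert (K2 : (1 + beta * r) * x < beta + r).
    { assert ((1 - beta * r) * ((1 + beta * r) * x) <
              (1 - beta * r) * (beta + r)); [|nra].
      assert ((1 + beta * r) * (beta - r) <= (1 - beta * r) * (beta + r)).
      { assert (0 <= r * (1 - beta ^ 2)) by (apply Rmult_le_pos; nra). nra. }
      nra. }
    nra. }
  apply Rmult_le_reg_l with (1 - beta * r); [lra|].
  (* Monotonicity in [beta]: [(beta - r) * (L - r) - (1 - beta * r) * (1 - L * r) = (beta * L - 1) *
     (1 - r ^ 2)]. *)
  apply Rle_trans with ((beta - r) * (L - r)); [|nra].
  assert (0 <= (beta * L - 1) * (1 - r ^ 2)) by (apply Rmult_le_pos; nra).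
  nra.
Qed.

(** * Distortion bounds *)

(** The rotation [c] makes [c * phi 0] a positive real number. It is the same for all [z], so the
    bound can be integrated along any segment. *)
Lemma derivative_lower_bound (phi : C -> C) (L : R) :
  holo unit_disk phi -> 1 <= Cmod (phi 0%C) ->
  (forall z, unit_disk z -> Cmod (phi z) <= L) ->
  exists c, Cmod c = 1 /\ forall z, unit_disk z ->
    L * (1 - L * Cmod z) / (L - Cmod z) <= Re (c * phi z).
Proof.
  intros Hh H0 Hb.
  pose proof (Hb _ unit_disk_0) as HbL.
  destruct (unit_rotation (phi 0%C)) as [c [Hc Hc0]]. exists c.
  split; [exact Hc|]. intros z Hz.
  pose proof (proj1 (unit_disk_Cmod z) Hz) as Hz1.
  pose proof (Cmod_ge_0 z) as Hz0.
  pose (p := fun w => (/ L * (c * phi w))%C).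
  assert (HL : 0 < / L) by (apply Rinv_0_lt_compat; lra).
  assert (HLL : / L * L = 1) by (apply Rinv_l; lra).
  assert (Hinv : (/ L)%C = RtoC (/ L)) by (symmetry; apply RtoC_inv; lra).
  assert (K : Cmod (p z - p 0%C) <= Cmod z * Cmod (1 - Cconj (p 0%C) * p z)).
  { apply schwarz_pick; [| |exact Hz].
    - apply holo_mult; [apply holo_const|].
      apply holo_mult; [apply holo_const | exact Hh].
    - intros w Hw. unfold p.
      rewrite Hinv, !Cmod_mult, Hc, Cmod_R, Rabs_pos_eq, Rmult_1_l by lra.
      rewrite <- HLL. apply Rmult_le_compat_l; [lra | now apply Hb]. }
  set (beta := / L * Cmod (phi 0%C)).
  assert (Hp0 : p 0%C = RtoC beta).
  { unfold p, beta. rewrite Hc0, Hinv, RtoC_mult. reflexivity. }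
  rewrite Hp0 in K.
  assert (Hre : Re (c * phi z) = L * Re (p z)).
  { unfold p. rewrite Hinv, re_scal_l, <- Rmult_assoc, Rinv_r by lra. ring. }
  rewrite Hre. apply Rmult_le_reg_r with (L - Cmod z); [lra|].
  replace (L * (1 - L * Cmod z) / (L - Cmod z) * (L - Cmod z))
    with (L * (1 - L * Cmod z)) by (field; lra).
  rewrite Rmult_assoc. apply Rmult_le_compat_l; [lra|].
  apply (schwarz_pick_re beta L (Cmod z) (Re (p z)) (Im (p z))); try lra.
  - unfold beta. replace (/ L * Cmod (phi 0%C) * L) with (Cmod (phi 0%C))
      by (field; lra). exact H0.
  - unfold beta. rewrite <- HLL. apply Rmult_le_compat_l; lra.
  - pose proof (pow_incr _ _ 2 (conj (Cmod_ge_0 _) K)) as K2.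
    rewrite Rpow_mult_distr, (Cmod2_alt (p z - beta)),
      (Cmod2_alt (1 - Cconj beta * p z)) in K2.
    revert K2. generalize (Cmod z ^ 2). intros r2. cparts.
    replace ((fst (p z) + - beta) ^ 2 + (snd (p z) + - 0) ^ 2)
      with ((fst (p z) - beta) ^ 2 + snd (p z) ^ 2) by ring.
    intros K2. eapply Rle_trans; [exact K2|]. right. ring.
Qed.

Lemma segment_in_closed_disk (z1 z2 : C) (rho t : R) :
  Cmod z1 <= rho -> Cmod z2 <= rho -> 0 <= t <= 1 ->
  Cmod (z1 + t * (z2 - z1)) <= rho.
Proof.
  intros H1 H2 Ht.
  replace (z1 + t * (z2 - z1))%C with ((1 - t)%R * z1 + t * z2)%C
    by (rewrite RtoC_minus; ring).
  eapply Rle_trans; [apply Cmod_triangle|].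
  rewrite !Cmod_mult, !Cmod_R, !Rabs_pos_eq by lra. nra.
Qed.

Lemma is_derive_segment (F : C -> C) (z v l c : C) (t : R) :
  cderiv F (z + t * v) l ->
  is_derive (fun s : R => Re (c * F (z + s * v)%C)) t (Re (c * l * v)).
Proof.
  intros HF. apply (cderiv_scal c) in HF.
  replace (z + t * v)%C with (Re z + t * Re v, Im z + t * Im v) in HF
    by (apply injective_projections; cparts; ring).
  replace (Re (c * l * v)) with (Re (c * l * (Re v, Im v))) by (cparts; ring).
  apply is_derive_ext with
    (fun s => Re (c * F (Re z + s * Re v, Im z + s * Im v))).
  - intros s. do 3 f_equal. apply injective_projections; cparts; ring.
  - apply (cderiv_re_path (fun w => c * F w)%C (fun s => Re z + s * Re v)
      (fun s => Im z + s * Im v)); [exact HF| |]; auto_derive; trivial; ring.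
Qed.

Lemma derive_ge_0_le (p dp : R -> R) :
  (forall t, 0 <= t <= 1 -> is_derive p t (dp t)) ->
  (forall t, 0 <= t <= 1 -> 0 <= dp t) -> p 0 <= p 1.
Proof.
  intros Hd Hp. destruct (MVT_gen p 0 1 dp) as [t [Ht E]].
  - intros t Ht. apply Hd. rewrite Rmin_left, Rmax_right in Ht by lra. lra.
  - intros t Ht. rewrite Rmin_left, Rmax_right in Ht by lra.
    apply continuity_pt_filterlim.
    apply (ex_derive_continuous (V := R_NormedModule)).
    eexists. now apply Hd.
  - rewrite Rmin_left, Rmax_right in Ht by lra. specialize (Hp t Ht). lra.
Qed.

Lemma Re_rotated_le (c v a b : C) :
  Cmod c = 1 ->
  Re (c * Cconj v * b) - Re (c * Cconj v * a) <= Cmod v * Cmod (b - a).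
Proof.
  intros Hc. rewrite <- re_minus.
  replace (c * Cconj v * b - c * Cconj v * a)%C
    with (c * Cconj v * (b - a))%C by ring.
  eapply Rle_trans; [apply Rle_abs|]. eapply Rle_trans; [apply re_le_Cmod|].
  rewrite !Cmod_mult, Hc, Cmod_conj. lra.
Qed.

Lemma Re_rotated_square (c v l : C) :
  Re (c * Cconj v * l * v) = Cmod v * (Cmod v * Re (c * l)).
Proof.
  replace (Cmod v * (Cmod v * Re (c * l))) with (Cmod v ^ 2 * Re (c * l)) by ring.
  rewrite Cmod2_alt. cparts. ring.
Qed.

(** The Noshiro-Warschawski argument: the disk is convex, and on a segment with direction [v] the
    function [Re (c * Cconj v * F)] grows at the rate [|v|^2 Re (c * phi)], hence at least at the
    rate [|v|^2 k]. *)
Lemma lipschitz_lower_bound (F phi : C -> C) (c : C) (rho k : R) :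
  Cmod c = 1 ->
  (forall z, Cmod z <= rho -> cderiv F z (phi z)) ->
  (forall z, Cmod z <= rho -> k <= Re (c * phi z)) ->
  forall z1 z2, Cmod z1 <= rho -> Cmod z2 <= rho ->
    k * Cmod (z2 - z1) <= Cmod (F z2 - F z1).
Proof.
  intros Hc HF Hk z1 z2 H1 H2. set (v := (z2 - z1)%C).
  destruct (Rle_lt_or_eq_dec _ _ (Cmod_ge_0 v)) as [Hv|Hv];
    [|rewrite <- Hv, Rmult_0_r; apply Cmod_ge_0].
  pose (p := fun t : R =>
    Re (c * Cconj v * F (z1 + t * v)%C) - Cmod v * (Cmod v * k) * t).
  assert (K : p 0 <= p 1).
  { apply derive_ge_0_le with
      (fun t : R => Re (c * Cconj v * phi (z1 + t * v)%C * v) - Cmod v * (Cmod v * k)).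
    - intros t Ht. apply (is_derive_minus (V := R_NormedModule)).
      + apply is_derive_segment. apply HF. now apply segment_in_closed_disk.
      + auto_derive; trivial; ring.
    - intros t Ht. rewrite Re_rotated_square.
      assert (Hk2 : k <= Re (c * phi (z1 + t * v)%C)).
      { apply Hk. now apply segment_in_closed_disk. }
      assert (Cmod v * (Cmod v * k) <= Cmod v * (Cmod v * Re (c * phi (z1 + t * v)%C))).
      { do 2 (apply Rmult_le_compat_l; [lra|]). exact Hk2. }
      lra. }
  unfold p in K.
  replace (z1 + 0 * v)%C with z1 in K by ring.
  replace (z1 + 1 * v)%C with z2 in K by (unfold v; ring).
  pose proof (Re_rotated_le c v (F z1) (F z2) Hc) as T.
  apply Rmult_le_reg_l with (Cmod v); [exact Hv|]. lra.
Qed.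

(** The integral of the Schwarz-Pick bound [L * (1 - L * s) / (L - s)] over [s] from 0 to [r]; its
    value at [/ L] is [r7]. *)
Definition growth (L r : R) : R := L * (L * r + (L ^ 2 - 1) * ln (1 - r / L)).

Lemma is_derive_growth (L r : R) :
  0 < L -> r < L -> is_derive (growth L) r (L * (1 - L * r) / (L - r)).
Proof.
  intros HL Hr. unfold growth.
  assert (Hp : 0 < 1 - r / L).
  { apply Rlt_0_minus. apply Rmult_lt_reg_r with L; [exact HL|].
    unfold Rdiv. rewrite Rmult_assoc, Rinv_l by lra. lra. }
  auto_derive; [exact Hp|]. field. repeat split; try lra.
Qed.

Lemma growth_0 (L : R) : growth L 0 = 0.
Proof.
  unfold growth. replace (1 - 0 / L) with 1 by (unfold Rdiv; ring).
  rewrite ln_1. ring.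
Qed.

(** The comparison of [lipschitz_lower_bound] on the ray from 0 to [z], with the radial bound at
    [t * Cmod z] in place of a constant. *)
Lemma growth_lower_bound (F phi : C -> C) (c : C) (L : R) :
  1 <= L -> Cmod c = 1 ->
  (forall z, unit_disk z -> cderiv F z (phi z)) ->
  (forall z, unit_disk z ->
     L * (1 - L * Cmod z) / (L - Cmod z) <= Re (c * phi z)) ->
  forall z, unit_disk z -> growth L (Cmod z) <= Cmod (F z - F 0%C).
Proof.
  intros HL Hc HF Hk z Hz. pose proof (proj1 (unit_disk_Cmod z) Hz) as Hz1.
  destruct (Rle_lt_or_eq_dec _ _ (Cmod_ge_0 z)) as [Hv|Hv];
    [|rewrite <- Hv, growth_0; apply Cmod_ge_0].
  assert (Hseg : forall t, 0 <= t <= 1 -> unit_disk (0 + t * z)%C).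
  { intros t Ht. apply unit_disk_Cmod. apply Rle_lt_trans with (Cmod z); [|exact Hz1].
    replace (0 + t * z)%C with (0 + t * (z - 0))%C by ring.
    apply segment_in_closed_disk; [rewrite Cmod_0|..]; lra. }
  pose (p := fun t : R =>
    Re (c * Cconj z * F (0 + t * z)%C) - Cmod z * growth L (t * Cmod z)).
  assert (K : p 0 <= p 1).
  { apply derive_ge_0_le with
      (fun t : R => Re (c * Cconj z * phi (0 + t * z)%C * z) -
        Cmod z * (Cmod z *
          (L * (1 - L * (t * Cmod z)) / (L - t * Cmod z)))).
    - intros t Ht. apply (is_derive_minus (V := R_NormedModule)).
      + apply is_derive_segment. apply HF. now apply Hseg.
      + apply is_derive_scal.
        apply (is_derive_comp (V := R_NormedModule) (growth L) (fun t => t * Cmod z)).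
        * apply is_derive_growth; [lra|]. nra.
        * auto_derive; trivial; ring.
    - intros t Ht. rewrite Re_rotated_square.
      pose proof (Hk _ (Hseg t Ht)) as K.
      assert (E : Cmod (0 + t * z)%C = t * Cmod z).
      { replace (0 + t * z)%C with (t * z)%C by ring.
        rewrite Cmod_mult, Cmod_R, Rabs_pos_eq; lra. }
      rewrite E in K.
      apply Rmult_le_compat_l with (r := Cmod z) in K; [|lra].
      apply Rmult_le_compat_l with (r := Cmod z) in K; [|lra].
      lra. }
  unfold p in K.
  replace (0 + 0 * z)%C with (RtoC 0) in K by ring.
  replace (0 + 1 * z)%C with z in K by ring.
  rewrite Rmult_0_l, Rmult_1_l, growth_0 in K.
  pose proof (Re_rotated_le c z (F 0%C) (F z) Hc) as T.
  apply Rmult_le_reg_l with (Cmod z); [exact Hv|]. lra.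
Qed.

(** The logarithm has coefficient [L ^ 2 - 1 = 0], so the value of [ln] at 0, which occurs for
    [r = 1], is immaterial. *)
Lemma growth_1 (r : R) : growth 1 r = r.
Proof. unfold growth. ring. Qed.

(** The condition [b < L] excludes the endpoint [b = L = 1], where the formula for the derivative
    has denominator 0. *)
Lemma growth_lt (L a b : R) :
  1 <= L -> 0 <= a < b -> b <= / L -> b < L ->
  growth L a < growth L b.
Proof.
  intros HL Hab Hb HbL.
  assert (HLL : / L * L = 1) by (apply Rinv_l; lra).
  assert (Hd : forall x, a <= x <= b ->
    is_derive (growth L) x (L * (1 - L * x) / (L - x))).
  { intros x Hx. apply is_derive_growth; lra. }
  destruct (MVT_cor2 (growth L) (fun x => L * (1 - L * x) / (L - x)) a b)
    as [x [E Hx]]; [lra| |].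
  { intros x Hx. apply is_derive_Reals. now apply Hd. }
  assert (0 < L * (1 - L * x) / (L - x)).
  { apply Rdiv_lt_0_compat; [|lra]. apply Rmult_lt_0_compat; [lra|]. nra. }
  nra.
Qed.

(** * Schlicht disks *)

Lemma cnear_locally (z : C) (P : C -> Prop) :
  cnear z P <-> locally (T := C_UniformSpace) z P.
Proof.
  rewrite cnear_2d. destruct z as [a b]. simpl.
  rewrite (locally_2d_locally (fun x y => P (x, y))).
  split; apply filter_imp; intros [x y]; easy.
Qed.

(** The real determinant of [v -> a v + b conj v] is [|a|^2 - |b|^2], the Jacobian. The witness is
    Cramer's rule for the equation together with its conjugate. *)
Lemma real_linear_onto (a b d : C) :
  Cmod b < Cmod a -> exists v, (a * v + b * Cconj v)%C = d.
Proof.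
  intros H. pose proof (Cmod_ge_0 b) as Hb.
  assert (Hn : (a * Cconj a - b * Cconj b)%C <> 0%C).
  { rewrite <- !Cmod2_conj, <- RtoC_minus. intros E. injection E. nra. }
  assert (Hr : Cconj (a * Cconj a - b * Cconj b) = (a * Cconj a - b * Cconj b)%C).
  { rewrite Cminus_conj, !Cmult_conj, !Cconj_conj. ring. }
  exists ((Cconj a * d - b * Cconj d) / (a * Cconj a - b * Cconj b))%C.
  rewrite Cdiv_conj, Hr, Cminus_conj, !Cmult_conj, !Cconj_conj by exact Hn.
  field. exact Hn.
Qed.

Section schlicht.

(** [a] and [b] are the Wirtinger derivatives of [f], [m] is [growth L], [r0] is [/ L] and [rho7] is
    [growth L (/ L)]. The Lipschitz constant may tend to 0 as [rho] approaches [r0], so every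
    argument is made on a smaller closed disk, and [m_exhausts] says that such disks suffice. *)
Variables (f a b : C -> C) (m : R -> R) (r0 rho7 : R).
Hypothesis f_diff : forall z, Cmod z < r0 -> forall eps, 0 < eps ->
  cnear z (fun w => Cmod (f w - f z - (a z * (w - z) + b z * Cconj (w - z)))
                    <= eps * Cmod (w - z)).
Hypothesis f_jac : forall z, Cmod z < r0 -> Cmod (b z) < Cmod (a z).
Hypothesis f_growth : forall z, Cmod z < r0 -> m (Cmod z) <= Cmod (f z).
Hypothesis f_lip : forall rho, rho < r0 -> exists k, 0 < k /\
  forall z1 z2, Cmod z1 <= rho -> Cmod z2 <= rho ->
    k * Cmod (z2 - z1) <= Cmod (f z2 - f z1).
Hypothesis m_exhausts : forall s, s < rho7 -> exists rho, 0 < rho < r0 /\ s < m rho.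
Hypothesis f_0 : f 0%C = 0%C.
Hypothesis r0_pos : 0 < r0.
Hypothesis rho7_pos : 0 < rho7.

Lemma schlicht_ccont (z : C) : Cmod z < r0 -> ccont f z.
Proof.
  intros Hz eps Heps.
  pose proof (Cmod_ge_0 (a z)) as Ha. pose proof (Cmod_ge_0 (b z)) as Hb.
  set (k := 1 + Cmod (a z) + Cmod (b z)).
  assert (Hk : 0 < k) by (unfold k; lra).
  assert (He : 0 < eps / k) by now apply Rdiv_lt_0_compat.
  assert (Hball : cnear z (fun w => Cmod (w - z) < eps / k)).
  { exists (eps / k). auto. }
  eapply cnear_impl; [|exact (cnear_and _ _ _ (f_diff z Hz 1 Rlt_0_1) Hball)].
  intros w [K1 K2]. cbv beta in K1, K2.
  set (l := (a z * (w - z) + b z * Cconj (w - z))%C) in *.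
  replace (f w - f z)%C with ((f w - f z - l) + l)%C by ring.
  eapply Rle_lt_trans; [apply Cmod_triangle|].
  assert (Hl : Cmod l <= (Cmod (a z) + Cmod (b z)) * Cmod (w - z)).
  { unfold l. eapply Rle_trans; [apply Cmod_triangle|].
    rewrite !Cmod_mult, Cmod_conj. lra. }
  apply Rle_lt_trans with (k * Cmod (w - z)); [unfold k; lra|].
  replace eps with (k * (eps / k)) by (field; lra).
  now apply Rmult_lt_compat_l.
Qed.

Lemma schlicht_univalent : univalent_on (disk 0%C r0) f.
Proof.
  intros z1 z2 H1 H2 E. rewrite disk_Cmod in H1, H2.
  destruct (f_lip (Rmax (Cmod z1) (Cmod z2))) as [k [Hk K]].
  { now apply Rmax_lub_lt. }
  specialize (K z1 z2 (Rmax_l _ _) (Rmax_r _ _)).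
  rewrite E in K. replace (f z2 - f z2)%C with (RtoC 0) in K by ring.
  rewrite Cmod_0 in K. pose proof (Cmod_ge_0 (z2 - z1)) as Hp.
  symmetry. apply Cminus_eq_0. apply Cmod_eq_0. nra.
Qed.

(* At a minimum of [|f - w|] off the boundary circle the surjectivity of the
   differential forces [f = w]. *)
Lemma schlicht_onto_step (rho : R) (z0 w : C) :
  rho < r0 -> Cmod z0 < rho -> Cmod (w - f z0) < m rho - Cmod w ->
  exists z, Cmod z < rho /\ f z = w.
Proof.
  intros Hrho Hz0 Hw.
  pose proof (Cmod_ge_0 z0) as Hz0p.
  destruct (closed_disk_max (fun z => - Cmod (f z - w)) rho) as [z [Hz Hmin]]; [lra| |].
  { intros z Hz eps Heps.
    assert (Hz2 : Cmod z < r0) by lra.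
    eapply cnear_impl; [|exact (schlicht_ccont z Hz2 eps Heps)].
    intros v Hv. cbv beta in Hv. eapply Rle_lt_trans; [|exact Hv].
    apply Rabs_le. split.
    - pose proof (Cmod_triangle_minus (f v - w) (f z - w)) as K.
      replace (f v - w - (f z - w))%C with (f v - f z)%C in K by ring. lra.
    - pose proof (Cmod_triangle_minus (f z - w) (f v - w)) as K.
      replace (f z - w - (f v - w))%C with (f z - f v)%C in K by ring.
      rewrite (Cmod_minus_sym (f z) (f v)) in K. lra. }
  pose proof (Hmin z0 (Rlt_le _ _ Hz0)) as K0. cbv beta in K0.
  rewrite (Cmod_minus_sym (f z0)) in K0.
  (* On the boundary circle [|f - w| >= m rho - |w|], which exceeds the value at [z0]. *)
  assert (Hzlt : Cmod z < rho).
  { destruct (Rle_lt_or_eq_dec _ _ Hz) as [H|H]; [exact H|exfalso].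
    pose proof (f_growth z ltac:(lra)) as K. rewrite H in K.
    pose proof (Cmod_triangle_minus (f z) w). lra. }
  exists z. split; [exact Hzlt|].
  apply NNPP. intros Hne.
  assert (Hd : 0 < Cmod (w - f z)).
  { apply Cmod_gt_0. intros E. apply Hne. symmetry. now apply Cminus_eq_0. }
  destruct (real_linear_onto (a z) (b z) (w - f z) (f_jac z ltac:(lra))) as [v Hv].
  pose proof (Cmod_ge_0 v) as Hvp.
  set (D := Cmod (w - f z)) in *.
  (* The step [t * v] moves [f z] towards [w] by [t * (w - f z)], up to an error [e * t * Cmod v].
     As [e * Cmod v < D], the distance to [w] falls below [D], against minimality. Below, [t] is
     taken small enough for the differential estimate and for staying in the disk. *)
  assert (He : 0 < D / (2 * (1 + Cmod v))) by (apply Rdiv_lt_0_compat; lra).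
  set (e := D / (2 * (1 + Cmod v))) in *.
  assert (Hev : e * Cmod v < D).
  { assert (e * (2 * (1 + Cmod v)) = D) by (unfold e; field; lra). nra. }
  destruct (f_diff z ltac:(lra) e He) as [d [Hd0 K]].
  set (t := Rmin (1 / 2) (Rmin (d / 2) ((rho - Cmod z) / 2) / (1 + Cmod v))).
  assert (Ht0 : 0 < t).
  { apply Rmin_pos; [lra|]. apply Rdiv_lt_0_compat; [|lra]. apply Rmin_pos; lra. }
  assert (Ht1 : t <= 1 / 2) by apply Rmin_l.
  assert (Htv : t * Cmod v <= Rmin (d / 2) ((rho - Cmod z) / 2)).
  { pose proof (Rmin_r (1 / 2) (Rmin (d / 2) ((rho - Cmod z) / 2) / (1 + Cmod v))) as T.
    fold t in T. apply Rmult_le_compat_r with (r := 1 + Cmod v) in T; [|lra].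
    replace (Rmin (d / 2) ((rho - Cmod z) / 2) / (1 + Cmod v) * (1 + Cmod v))
      with (Rmin (d / 2) ((rho - Cmod z) / 2)) in T by (field; lra).
    nra. }
  pose proof (Rmin_l (d / 2) ((rho - Cmod z) / 2)) as M1.
  pose proof (Rmin_r (d / 2) ((rho - Cmod z) / 2)) as M2.
  assert (Htvm : Cmod (t * v) = t * Cmod v).
  { rewrite Cmod_mult, Cmod_R, Rabs_pos_eq; lra. }
  assert (Hin : Cmod (z + t * v) <= rho).
  { eapply Rle_trans; [apply Cmod_triangle|]. rewrite Htvm. lra. }
  specialize (Hmin _ Hin). cbv beta in Hmin.
  assert (Hnear : Cmod (z + t * v - z) < d).
  { replace (z + t * v - z)%C with (t * v)%C by ring. rewrite Htvm. lra. }
  specialize (K _ Hnear).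
  replace (z + t * v - z)%C with (t * v)%C in K by ring.
  replace (a z * (t * v) + b z * Cconj (t * v))%C with (t * (w - f z))%C in K.
  2:{ rewrite <- Hv, Cmult_conj. replace (Cconj t) with (RtoC t).
      - ring.
      - apply injective_projections; cparts; ring. }
  rewrite Htvm in K.
  assert (T : Cmod (f (z + t * v)%C - w) <= (1 - t) * D + e * (t * Cmod v)).
  { replace (f (z + t * v)%C - w)%C with
      ((f (z + t * v)%C - f z - t * (w - f z)) + - ((1 - t)%R * (w - f z)))%C
      by (rewrite RtoC_minus; ring).
    eapply Rle_trans; [apply Cmod_triangle|].
    rewrite Cmod_opp, Cmod_mult, Cmod_R, Rabs_pos_eq by lra. fold D. lra. }
  rewrite (Cmod_minus_sym (f z)) in Hmin. fold D in Hmin. nra.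
Qed.

(** The segment from 0 to [w] is cut into [n] pieces of length [|w| / n < m rho - |w|]. Every
    division point has modulus at most [|w|], so [schlicht_onto_step] leads from each one to the
    next. *)
Lemma schlicht_onto (rho : R) (w : C) :
  0 < rho < r0 -> Cmod w < m rho -> exists z, Cmod z < rho /\ f z = w.
Proof.
  intros Hrho Hw.
  pose proof (Cmod_ge_0 w) as Hwp.
  destruct (INR_unbounded (Cmod w / (m rho - Cmod w))) as [n0 Hn0].
  pose (n := S n0).
  assert (Hn : 0 < INR n) by apply lt_0_INR, Nat.lt_0_succ.
  assert (Hn2 : Cmod w < INR n * (m rho - Cmod w)).
  { unfold n. rewrite S_INR.
    apply Rmult_lt_compat_r with (r := m rho - Cmod w) in Hn0; [|lra].
    unfold Rdiv in Hn0. rewrite Rmult_assoc, Rinv_l in Hn0 by lra. lra. }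
  assert (H : forall k, (k <= n)%nat ->
    exists z, Cmod z < rho /\ f z = ((INR k / INR n)%R * w)%C).
  { induction k as [|k IH]; intros Hk.
    - exists 0%C. rewrite Cmod_0, f_0. split; [lra|].
      unfold Rdiv. simpl. rewrite Rmult_0_l. ring.
    - destruct IH as [z0 [Hz0 E]]; [lia|].
      apply (schlicht_onto_step rho z0); [lra|exact Hz0|].
      rewrite E.
      assert (Hkn : INR (S k) <= INR n) by now apply le_INR.
      assert (Hq : INR (S k) / INR n <= 1).
      { apply Rmult_le_reg_r with (INR n); [exact Hn|]. unfold Rdiv.
        rewrite Rmult_assoc, Rinv_l by lra. lra. }
      assert (Hq0 : 0 <= INR (S k) / INR n).
      { apply Rmult_le_pos; [apply pos_INR|]. left. now apply Rinv_0_lt_compat. }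
      replace ((INR (S k) / INR n)%R * w - (INR k / INR n)%R * w)%C
        with ((1 / INR n)%R * w)%C.
      2:{ replace (1 / INR n) with (INR (S k) / INR n - INR k / INR n)
            by (rewrite S_INR; field; lra).
          rewrite RtoC_minus. ring. }
      rewrite !Cmod_mult, !Cmod_R, !Rabs_pos_eq; [|exact Hq0|].
      2:{ left. apply Rdiv_lt_0_compat; lra. }
      apply Rlt_le_trans with (m rho - Cmod w); [|nra].
      apply Rmult_lt_reg_l with (INR n); [exact Hn|].
      replace (INR n * (1 / INR n * Cmod w)) with (Cmod w) by (field; lra).
      exact Hn2. }
  destruct (H n (le_n n)) as [z [Hz E]]. exists z. split; [exact Hz|].
  rewrite E. replace (INR n / INR n) with 1 by (field; lra). ring.
Qed.

Definition schlicht_domain (z : C) : Prop := Cmod z < r0 /\ Cmod (f z) < rho7.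

Lemma schlicht_domain_open : open (T := C_UniformSpace) schlicht_domain.
Proof.
  intros z [H1 H2]. apply (cnear_locally z).
  assert (K1 : cnear z (fun w => Cmod w < r0)).
  { eapply cnear_impl; [|apply (cnear_disk 0%C z r0)].
    - intros w. apply disk_Cmod.
    - now apply disk_Cmod. }
  exact (cnear_and _ _ _ K1 (ccont_near_lt f z rho7 (schlicht_ccont z H1) H2)).
Qed.

(* Two points of the domain are joined by the preimage of the segment between
   their images, on which the inverse of [f] is Lipschitz. *)
Lemma schlicht_domain_connected : connected_set schlicht_domain.
Proof.
  intros U V HU HV Hcov [zU [[HzU HfU] HUU]] [zV [[HzV HfV] HVV]].
  apply NNPP. intros Hno.
  set (s := Rmax (Cmod (f zU)) (Cmod (f zV))).
  assert (Hs : s < rho7) by now apply Rmax_lub_lt.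
  destruct (m_exhausts s Hs) as [rho [Hrho Hm]].
  pose (w := fun t : R => (f zU + t * (f zV - f zU))%C).
  assert (Hw : forall t, 0 <= t <= 1 -> Cmod (w t) <= s).
  { intros t Ht. apply segment_in_closed_disk; [apply Rmax_l|apply Rmax_r|exact Ht]. }
  assert (Hpre : forall t, 0 <= t <= 1 -> exists z, Cmod z < rho /\ f z = w t).
  { intros t Ht. apply schlicht_onto; [exact Hrho|].
    eapply Rle_lt_trans; [now apply Hw|exact Hm]. }
  assert (Hdom : forall t z, 0 <= t <= 1 -> Cmod z < rho -> f z = w t ->
    schlicht_domain z).
  { intros t z Ht Hz E. split; [lra|]. rewrite E.
    eapply Rle_lt_trans; [now apply Hw|exact Hs]. }
  destruct (f_lip rho) as [k [Hk Hlip]]; [lra|].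
  set (D := Cmod (f zV - f zU)).
  assert (HD : 0 <= D) by apply Cmod_ge_0.
  (* A property that holds near the preimage of [w t] persists for parameters near [t], because the
     inverse has Lipschitz constant [1 / k]; [D + 1] guards against division by 0. *)
  assert (Hcont : forall t z (P : C -> Prop), 0 <= t <= 1 -> Cmod z < rho ->
    f z = w t -> cnear z P -> exists d, 0 < d /\
    forall t' z', 0 <= t' <= 1 -> Cmod z' < rho -> f z' = w t' ->
      Rabs (t' - t) < d -> P z').
  { intros t z P Ht Hz E [e [He HP]]. exists (k * e / (D + 1)). split.
    { apply Rdiv_lt_0_compat; [|lra]. now apply Rmult_lt_0_compat. }
    intros t' z' Ht' Hz' E' Hd. apply HP.
    apply Rmult_lt_reg_l with k; [exact Hk|].
    eapply Rle_lt_trans; [apply Hlip; lra|]. rewrite E, E'. unfold w.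
    replace (f zU + t' * (f zV - f zU) - (f zU + t * (f zV - f zU)))%C
      with ((t' - t)%R * (f zV - f zU))%C by (rewrite RtoC_minus; ring).
    rewrite Cmod_mult, Cmod_R. fold D.
    apply Rmult_lt_compat_r with (r := D + 1) in Hd; [|lra].
    replace (k * e / (D + 1) * (D + 1)) with (k * e) in Hd by (field; lra).
    pose proof (Rabs_pos (t' - t)). lra. }
  pose (S := fun t => 0 <= t <= 1 /\ exists z, Cmod z < rho /\ f z = w t /\ U z).
  assert (Hw0 : w 0 = f zU) by (unfold w; ring).
  assert (Hw1 : w 1 = f zV) by (unfold w; ring).
  assert (Huniq : forall z z', Cmod z < r0 -> Cmod z' < r0 -> f z = f z' -> z = z').
  { intros z z' H1 H2. apply schlicht_univalent; now apply disk_Cmod. }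
  assert (HS0 : S 0).
  { split; [lra|]. destruct (Hpre 0) as [z [Hz E]]; [lra|].
    exists z. repeat split; try assumption.
    replace z with zU; [exact HUU|]. apply Huniq; [assumption|lra|congruence]. }
  destruct (completeness S) as [T [Hub Hlub]].
  { exists 1. intros t [Ht _]. lra. }
  { now exists 0. }
  assert (HT : 0 <= T <= 1).
  { split; [now apply Hub|]. apply Hlub. intros t [Ht _]. lra. }
  destruct (Hpre T HT) as [z [Hz E]].
  (* If the preimage at the supremum [T] lies in [U], either [T] can be exceeded or [T = 1] and [zV]
     lies in both sets. If it lies in [V], then so do the preimages for parameters near [T], some of
     which belong to [S]. *)
  destruct (Hcov z (Hdom T z HT Hz E)) as [Hin|Hin].
  - destruct (Hcont T z U HT Hz E (proj2 (cnear_locally z U) (HU z Hin)))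
      as [d [Hd K]].
    destruct (Rle_lt_or_eq_dec T 1 (proj2 HT)) as [HT1|HT1].
    + set (t' := Rmin 1 (T + d / 2)).
      assert (Ht' : T < t' <= 1).
      { split; [|apply Rmin_l]. apply Rmin_glb_lt; lra. }
      assert (Ht2 : t' <= T + d / 2) by apply Rmin_r.
      destruct (Hpre t') as [z' [Hz' E']]; [lra|].
      assert (t' <= T); [|lra].
      apply Hub. split; [lra|]. exists z'. repeat split; try assumption.
      apply (K t'); try assumption; [lra|]. rewrite Rabs_pos_eq; lra.
    + apply Hno. exists zV. split; [now split|]. split; [|exact HVV].
      replace zV with z; [exact Hin|]. apply Huniq; [lra|assumption|].
      rewrite E, HT1. exact Hw1.
  - destruct (Hcont T z V HT Hz E (proj2 (cnear_locally z V) (HV z Hin)))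
      as [d [Hd K]].
    assert (T <= T - d); [|lra].
    apply Hlub. intros t [Ht [z' [Hz' [E' HU']]]].
    apply Rnot_lt_le. intros Hlt.
    assert (t <= T) by (apply Hub; split; [lra|]; now exists z').
    apply Hno. exists z'. split; [now apply (Hdom t)|]. split; [exact HU'|].
    apply (K t); try assumption. apply Rabs_def1; lra.
Qed.

Lemma schlicht_disk : contains_schlicht_disk f (disk 0%C r0) 0%C rho7.
Proof.
  exists schlicht_domain. repeat split.
  - exists 0%C. split; [|rewrite f_0]; now rewrite Cmod_0.
  - apply schlicht_domain_open.
  - apply schlicht_domain_connected.
  - intros z [Hz _]. now apply disk_Cmod.
  - intros z1 z2 [H1 _] [H2 _]. apply schlicht_univalent; now apply disk_Cmod.
  - intros [z [[_ Hz] <-]]. now apply disk_Cmod.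
  - intros Hw. rewrite disk_Cmod in Hw.
    destruct (m_exhausts _ Hw) as [rho [Hrho Hm]].
    destruct (schlicht_onto rho w Hrho Hm) as [z [Hz E]].
    exists z. split; [split; [lra|now rewrite E]|exact E].
Qed.

End schlicht.

(** * Harmonic mappings *)

Lemma cnear_re (z : C) (P : C -> Prop) :
  cnear z P -> locally (Re z) (fun t : R => P (t, Im z)).
Proof. intros H. apply cnear_2d in H. exact (locally_2d_1d_const_y _ _ _ H). Qed.

Lemma cnear_im (z : C) (P : C -> Prop) :
  cnear z P -> locally (Im z) (fun t : R => P (Re z, t)).
Proof. intros H. apply cnear_2d in H. exact (locally_2d_1d_const_x _ _ _ H). Qed.

Lemma cderiv_partials (F : C -> C) (z l : C) :
  cderiv F z l ->
  is_derive (fun t => Re (F (t, Im z))) (Re z) (Re l) /\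
  is_derive (fun t => Im (F (t, Im z))) (Re z) (Im l) /\
  is_derive (fun t => Re (F (Re z, t))) (Im z) (- Im l) /\
  is_derive (fun t => Im (F (Re z, t))) (Im z) (Re l).
Proof.
  intros H. destruct z as [x y]. simpl.
  assert (H1 : is_derive (fun t : R => t) x 1)
    by apply (is_derive_id (K := R_AbsRing)).
  assert (H2 : is_derive (fun _ : R => y) x 0)
    by apply (is_derive_const (V := R_NormedModule)).
  assert (H3 : is_derive (fun t : R => t) y 1)
    by apply (is_derive_id (K := R_AbsRing)).
  assert (H4 : is_derive (fun _ : R => x) y 0)
    by apply (is_derive_const (V := R_NormedModule)).
  split; [|split; [|split]].
  - replace (Re l) with (Re (l * (1, 0))) by (cparts; ring).
    exact (cderiv_re_path F (fun t => t) (fun _ => y) x 1 0 l H H1 H2).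
  - replace (Im l) with (Im (l * (1, 0))) by (cparts; ring).
    exact (cderiv_im_path F (fun t => t) (fun _ => y) x 1 0 l H H1 H2).
  - replace (- Im l) with (Re (l * (0, 1))) by (cparts; ring).
    exact (cderiv_re_path F (fun _ => x) (fun t => t) y 0 1 l H H4 H3).
  - replace (Re l) with (Im (l * (0, 1))) by (cparts; ring).
    exact (cderiv_im_path F (fun _ => x) (fun t => t) y 0 1 l H H4 H3).
Qed.

(** Turns [Lambda], [lambda] and [jacobian], which are defined by partial derivatives, into
    expressions in [|h'|] and [|g'|]. *)
Lemma wirtinger_decomposition (f h g : C -> C) (z l k : C) :
  cnear z (fun w => f w = (h w + Cconj (g w))%C) ->
  cderiv h z l -> cderiv g z k ->
  dz f z = l /\ dzbar f z = Cconj k.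
Proof.
  intros Hf Hh Hg.
  destruct (cderiv_partials h z l Hh) as [h1 [h2 [h3 h4]]].
  destruct (cderiv_partials g z k Hg) as [g1 [g2 [g3 g4]]].
  assert (Ex : dx f z = (l + Cconj k)%C).
  { unfold dx. apply injective_projections; simpl; apply is_derive_unique.
    - apply is_derive_ext_loc with
        (fun t => Re (h (t, Im z)) + Re (g (t, Im z))).
      + generalize (cnear_re _ _ Hf). apply filter_imp. intros t Et.
        rewrite Et. reflexivity.
      + exact (is_derive_plus (V := R_NormedModule) _ _ _ _ _ h1 g1).
    - apply is_derive_ext_loc with
        (fun t => Im (h (t, Im z)) - Im (g (t, Im z))).
      + generalize (cnear_re _ _ Hf). apply filter_imp. intros t Et.
        rewrite Et. reflexivity.
      + exact (is_derive_minus (V := R_NormedModule) _ _ _ _ _ h2 g2). }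
  assert (Ey : dy f z = (Ci * (l - Cconj k))%C).
  { unfold dy. apply injective_projections; simpl; apply is_derive_unique.
    - apply is_derive_ext_loc with
        (fun t => Re (h (Re z, t)) + Re (g (Re z, t))).
      + generalize (cnear_im _ _ Hf). apply filter_imp. intros t Et.
        rewrite Et. reflexivity.
      + pose proof (is_derive_plus (V := R_NormedModule) _ _ _ _ _ h3 g3) as K.
        replace (_ - _) with (- Im l + - Im k) by (cparts; ring). exact K.
    - apply is_derive_ext_loc with
        (fun t => Im (h (Re z, t)) - Im (g (Re z, t))).
      + generalize (cnear_im _ _ Hf). apply filter_imp. intros t Et.
        rewrite Et. reflexivity.
      + pose proof (is_derive_minus (V := R_NormedModule) _ _ _ _ _ h4 g4) as K.
        replace (_ + _) with (Re l - Re k) by (cparts; ring). exact K. }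
  unfold dz, dzbar. rewrite Ex, Ey.
  split.
  - replace (l + Cconj k - Ci * (Ci * (l - Cconj k)))%C
      with (l + Cconj k - (Ci * Ci) * (l - Cconj k))%C by ring.
    replace (Ci * Ci)%C with (- (1))%C
      by (apply injective_projections; cparts; ring).
    field.
  - replace (l + Cconj k + Ci * (Ci * (l - Cconj k)))%C
      with (l + Cconj k + (Ci * Ci) * (l - Cconj k))%C by ring.
    replace (Ci * Ci)%C with (- (1))%C
      by (apply injective_projections; cparts; ring).
    field.
Qed.

(** Continuity of the partial derivatives of the combination needs the sum rule at nearby points
    too, hence the hypotheses on a neighbourhood. *)
Lemma ex_diff_1_lin (U V : R -> R -> R) (a b x y : R) :
  locally_2d (ex_diff_n U 1) x y -> locally_2d (ex_diff_n V 1) x y ->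
  ex_diff_n (fun x y => a * U x y + b * V x y) 1 x y.
Proof.
  intros HU HV.
  assert (Hd : forall u v, ex_diff_n U 1 u v -> ex_diff_n V 1 u v ->
    is_derive (fun t => a * U t v + b * V t v) u
      (a * Derive (fun t => U t v) u + b * Derive (fun t => V t v) u) /\
    is_derive (fun t => a * U u t + b * V u t) v
      (a * Derive (fun t => U u t) v + b * Derive (fun t => V u t) v)).
  { intros u v [_ [U1 [U2 _]]] [_ [V1 [V2 _]]].
    split; apply (is_derive_plus (V := R_NormedModule));
      apply is_derive_scal; now apply Derive_correct. }
  pose proof (locally_2d_and _ _ _ _ HU HV) as HUV.
  pose proof (locally_2d_singleton _ _ _ HU) as U0.
  pose proof (locally_2d_singleton _ _ _ HV) as V0.
  destruct (Hd x y U0 V0) as [D1 D2].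
  destruct U0 as [UC [_ [_ [[U1 _] [U2 _]]]]].
  destruct V0 as [VC [_ [_ [[V1 _] [V2 _]]]]].
  assert (Hlin : forall P Q, continuity_2d_pt P x y -> continuity_2d_pt Q x y ->
    continuity_2d_pt (fun x y => a * P x y + b * Q x y) x y).
  { intros P Q HP HQ. apply continuity_2d_pt_plus;
      (apply continuity_2d_pt_mult; [apply continuity_2d_pt_const|assumption]). }
  split; [now apply Hlin|]. split; [now eexists; apply D1|].
  split; [now eexists; apply D2|]. split; (split; [|exact I]).
  - eapply continuity_2d_pt_ext_loc; [|exact (Hlin _ _ U1 V1)].
    revert HUV. apply locally_2d_impl, locally_2d_forall. intros u v [K1 K2].
    symmetry. apply is_derive_unique. now apply Hd.
  - eapply continuity_2d_pt_ext_loc; [|exact (Hlin _ _ U2 V2)].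
    revert HUV. apply locally_2d_impl, locally_2d_forall. intros u v [K1 K2].
    symmetry. apply is_derive_unique. now apply Hd.
Qed.

Lemma Derive_lin (U V : R -> R) (a b x : R) :
  ex_derive U x -> ex_derive V x ->
  Derive (fun t => a * U t + b * V t) x = a * Derive U x + b * Derive V x.
Proof.
  intros HU HV. rewrite Derive_plus, !Derive_scal; [reflexivity| |];
    now apply ex_derive_scal.
Qed.

Lemma unit_disk_locally_2d (z : C) (P : R -> R -> Prop) :
  unit_disk z -> (forall w, unit_disk w -> P (Re w) (Im w)) ->
  locally_2d P (Re z) (Im z).
Proof.
  intros Hz H. apply (cnear_2d z (fun w => P (Re w) (Im w))).
  eapply cnear_impl; [|exact (cnear_disk _ _ _ Hz)]. exact H.
Qed.

Lemma cauchy_riemann_holo (G : C -> C) (P Q : R -> R -> R) :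
  (forall x y, G (x, y) = (P x y, Q x y)) ->
  (forall z, unit_disk z ->
     ex_diff_n P 1 (Re z) (Im z) /\ ex_diff_n Q 1 (Re z) (Im z) /\
     Derive (fun t => P t (Im z)) (Re z) = Derive (fun t => Q (Re z) t) (Im z) /\
     Derive (fun t => P (Re z) t) (Im z) = - Derive (fun t => Q t (Im z)) (Re z)) ->
  holo unit_disk G.
Proof.
  intros HG H.
  exists (fun z => (Derive (fun t => P t (Im z)) (Re z),
                    Derive (fun t => Q t (Im z)) (Re z))).
  intros z Hz. destruct (H z Hz) as [HP [HQ [E1 E2]]]. split.
  - assert (DP : differentiable_pt_lim P (Re z) (Im z)
      (Derive (fun t => P t (Im z)) (Re z)) (Derive (fun t => P (Re z) t) (Im z))).
    { apply C1_differentiable. apply unit_disk_locally_2d; [exact Hz|]. apply H. }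
    assert (DQ : differentiable_pt_lim Q (Re z) (Im z)
      (Derive (fun t => Q t (Im z)) (Re z)) (Derive (fun t => Q (Re z) t) (Im z))).
    { apply C1_differentiable. apply unit_disk_locally_2d; [exact Hz|]. apply H. }
    rewrite E2 in DP. rewrite <- E1 in DQ.
    apply cauchy_riemann_cderiv.
    + eapply differentiable_pt_lim_ext; [|exact DP].
      apply locally_2d_forall. intros u v. now rewrite HG.
    + eapply differentiable_pt_lim_ext; [|exact DQ].
      apply locally_2d_forall. intros u v. now rewrite HG.
  - apply ccont_2d. split.
    + apply HP.
    + apply HQ.
Qed.

Lemma C2_schwarz (u : R -> R -> R) (z : C) :
  unit_disk z ->
  (forall w, unit_disk w -> ex_diff_n u 2 (Re w) (Im w)) ->
  Derive (fun s => Derive (fun t => u s t) (Im z)) (Re z) =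
  Derive (fun s => Derive (fun t => u t s) (Re z)) (Im z).
Proof.
  intros Hz H. apply Schwarz.
  - apply unit_disk_locally_2d; [exact Hz|]. intros w Hw.
    destruct (H w Hw) as [_ [K1 [K2 [[_ [_ [K3 _]]] [_ [K4 _]]]]]]. tauto.
  - destruct (H z Hz) as [_ [_ [_ [_ [_ [_ [_ [[K _] _]]]]]]]]. exact K.
  - destruct (H z Hz) as [_ [_ [_ [[_ [_ [_ [_ [K _]]]]] _]]]]. exact K.
Qed.

(** The equation [f_{z zbar} = 0] is the Cauchy-Riemann system of [dz f], and after exchanging mixed
    partial derivatives also that of the conjugate of [dzbar f]. Both have continuous first
    derivatives because [f] is of class C^2. *)
Lemma harmonic_holo (f : C -> C) :
  harmonic_mapping f ->
  holo unit_disk (dz f) /\ holo unit_disk (fun z => Cconj (dzbar f z)).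
Proof.
  intros [HC2 Hharm].
  pose (u := fun x y => Re (f (x, y))). pose (v := fun x y => Im (f (x, y))).
  pose (D1 := fun (w : R -> R -> R) x y => Derive (fun t => w t y) x).
  pose (D2 := fun (w : R -> R -> R) x y => Derive (fun t => w x t) y).
  assert (Hu : forall w, unit_disk w -> ex_diff_n u 2 (Re w) (Im w))
    by (intros w Hw; apply HC2; exact Hw).
  assert (Hv : forall w, unit_disk w -> ex_diff_n v 2 (Re w) (Im w))
    by (intros w Hw; apply HC2; exact Hw).
  assert (Hu1 : forall w, unit_disk w -> ex_diff_n (D1 u) 1 (Re w) (Im w))
    by (intros w Hw; apply (Hu w Hw)).
  assert (Hu2 : forall w, unit_disk w -> ex_diff_n (D2 u) 1 (Re w) (Im w))
    by (intros w Hw; apply (Hu w Hw)).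
  assert (Hv1 : forall w, unit_disk w -> ex_diff_n (D1 v) 1 (Re w) (Im w))
    by (intros w Hw; apply (Hv w Hw)).
  assert (Hv2 : forall w, unit_disk w -> ex_diff_n (D2 v) 1 (Re w) (Im w))
    by (intros w Hw; apply (Hv w Hw)).
  assert (Hlin : forall U V a b,
    (forall w, unit_disk w -> ex_diff_n U 1 (Re w) (Im w)) ->
    (forall w, unit_disk w -> ex_diff_n V 1 (Re w) (Im w)) ->
    forall w, unit_disk w ->
      ex_diff_n (fun x y => a * U x y + b * V x y) 1 (Re w) (Im w) /\
      D1 (fun x y => a * U x y + b * V x y) (Re w) (Im w) =
        a * D1 U (Re w) (Im w) + b * D1 V (Re w) (Im w) /\
      D2 (fun x y => a * U x y + b * V x y) (Re w) (Im w) =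
        a * D2 U (Re w) (Im w) + b * D2 V (Re w) (Im w)).
  { intros U V a b HU HV w Hw. split; [|split].
    - apply ex_diff_1_lin; now apply unit_disk_locally_2d.
    - apply Derive_lin; [apply (HU w Hw) | apply (HV w Hw)].
    - apply Derive_lin; [apply (HU w Hw) | apply (HV w Hw)]. }
  pose (P := fun x y => / 2 * D1 u x y + / 2 * D2 v x y).
  pose (Q := fun x y => / 2 * D1 v x y + - / 2 * D2 u x y).
  pose (P' := fun x y => / 2 * D1 u x y + - / 2 * D2 v x y).
  pose (Q' := fun x y => - / 2 * D1 v x y + - / 2 * D2 u x y).
  assert (Edz : forall x y, dz f (x, y) = (P x y, Q x y)).
  { intros x y. unfold dz, dx, dy.
    change (Derive (fun t => Re (f (t, Im (x, y)))) (Re (x, y)))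
      with (D1 u x y).
    change (Derive (fun t => Im (f (t, Im (x, y)))) (Re (x, y))) with (D1 v x y).
    change (Derive (fun t => Re (f (Re (x, y), t))) (Im (x, y))) with (D2 u x y).
    change (Derive (fun t => Im (f (Re (x, y), t))) (Im (x, y))) with (D2 v x y).
    unfold P, Q. apply injective_projections; cparts; field. }
  assert (Edzb : forall x y, Cconj (dzbar f (x, y)) = (P' x y, Q' x y)).
  { intros x y. unfold dzbar, dx, dy.
    change (Derive (fun t => Re (f (t, Im (x, y)))) (Re (x, y)))
      with (D1 u x y).
    change (Derive (fun t => Im (f (t, Im (x, y)))) (Re (x, y))) with (D1 v x y).
    change (Derive (fun t => Re (f (Re (x, y), t))) (Im (x, y))) with (D2 u x y).
    change (Derive (fun t => Im (f (Re (x, y), t))) (Im (x, y))) with (D2 v x y).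
    unfold P', Q'. apply injective_projections; cparts; field. }
  assert (HCR : forall z, unit_disk z ->
    D1 P (Re z) (Im z) = D2 Q (Re z) (Im z) /\
    D2 P (Re z) (Im z) = - D1 Q (Re z) (Im z)).
  { intros z Hz. pose proof (Hharm z Hz) as E.
    unfold dzbar, dx, dy in E.
    rewrite (Derive_ext (fun t => Re (dz f (t, Im z))) (fun t => P t (Im z))) in E
      by (intros t; now rewrite Edz).
    rewrite (Derive_ext (fun t => Im (dz f (t, Im z))) (fun t => Q t (Im z))) in E
      by (intros t; now rewrite Edz).
    rewrite (Derive_ext (fun t => Re (dz f (Re z, t))) (fun t => P (Re z) t)) in E
      by (intros t; now rewrite Edz).
    rewrite (Derive_ext (fun t => Im (dz f (Re z, t))) (fun t => Q (Re z) t)) in E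
      by (intros t; now rewrite Edz).
    fold (D1 P (Re z) (Im z)) in E. fold (D1 Q (Re z) (Im z)) in E.
    fold (D2 P (Re z) (Im z)) in E. fold (D2 Q (Re z) (Im z)) in E.
    pose proof (f_equal fst E) as E1. pose proof (f_equal snd E) as E2.
    revert E1 E2. cparts. intros E1 E2. field_simplify in E1.
    field_simplify in E2. split; lra. }
  split.
  - apply (cauchy_riemann_holo _ P Q Edz). intros z Hz.
    destruct (Hlin _ _ (/ 2) (/ 2) Hu1 Hv2 z Hz) as [KP _].
    destruct (Hlin _ _ (/ 2) (- / 2) Hv1 Hu2 z Hz) as [KQ _].
    destruct (HCR z Hz) as [E1 E2]. auto.
  - apply (cauchy_riemann_holo _ P' Q' Edzb). intros z Hz.
    destruct (Hlin _ _ (/ 2) (/ 2) Hu1 Hv2 z Hz) as [_ [KP1 KP2]].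
    destruct (Hlin _ _ (/ 2) (- / 2) Hv1 Hu2 z Hz) as [_ [KQ1 KQ2]].
    destruct (Hlin _ _ (/ 2) (- / 2) Hu1 Hv2 z Hz) as [KP' [KP1' KP2']].
    destruct (Hlin _ _ (- / 2) (- / 2) Hv1 Hu2 z Hz) as [KQ' [KQ1' KQ2']].
    destruct (HCR z Hz) as [E1 E2].
    (* With symmetric second derivatives both systems say that [u] and [v] are harmonic. *)
    pose proof (C2_schwarz u z Hz Hu) as Su. pose proof (C2_schwarz v z Hz Hv) as Sv.
    fold (D1 (D2 u) (Re z) (Im z)) in Su. fold (D2 (D1 u) (Re z) (Im z)) in Su.
    fold (D1 (D2 v) (Re z) (Im z)) in Sv. fold (D2 (D1 v) (Re z) (Im z)) in Sv.
    change (D1 (D2 u) (Re z) (Im z) = D2 (D1 u) (Re z) (Im z)) in Su.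
    change (D1 (D2 v) (Re z) (Im z) = D2 (D1 v) (Re z) (Im z)) in Sv.
    fold P in KP1, KP2. fold Q in KQ1, KQ2.
    split; [exact KP'|]. split; [exact KQ'|].
    change (D1 P' (Re z) (Im z) = D2 Q' (Re z) (Im z) /\
            D2 P' (Re z) (Im z) = - D1 Q' (Re z) (Im z)).
    fold P' in KP1', KP2'. fold Q' in KQ1', KQ2'.
    split; lra.
Qed.

(** * The Landau-Bloch radii *)

Lemma analytic_cderiv (h : C -> C) (z : C) :
  analytic_on_disk h -> unit_disk z -> cderiv h z (C_derive h z).
Proof.
  intros Hh Hz. apply is_derive_cderiv.
  exact (C_derive_correct h z 0%C (Hh z Hz)).
Qed.

Lemma cnear_punctured_point (z : C) (P : C -> Prop) :
  cnear z P -> exists w, w <> z /\ P w.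
Proof.
  intros [d [Hd H]]. exists (z + (d / 2)%R)%C.
  assert (E : (z + (d / 2)%R - z)%C = RtoC (d / 2)) by ring.
  split.
  - intros K. rewrite K in E. replace (z - z)%C with (RtoC 0) in E by ring.
    injection E. lra.
  - apply H. rewrite E, Cmod_R, Rabs_pos_eq; lra.
Qed.

Lemma Cmod_unit_inv (e : C) : Cmod e = 1 -> (e * Cconj e)%C = 1%C.
Proof. intros H. rewrite <- Cmod2_conj, H. f_equal. ring. Qed.

(** Choosing [e] so that [e * B] points against [A] gives [|A + e B| = ||A| - |B||], a lower bound
    for [|A + conj B|]. With the increments of [h] and [g] as [A] and [B], this compares [F_e] with
    [f]. *)
Lemma aligning_unit (A B : C) :
  exists e, Cmod e = 1 /\ Cmod (A + e * B) <= Cmod (A + Cconj B).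
Proof.
  destruct (unit_rotation A) as [c1 [H1 E1]].
  destruct (unit_rotation B) as [c2 [H2 E2]].
  exists (- (Cconj c1 * c2))%C. split.
  { rewrite Cmod_opp, Cmod_mult, Cmod_conj. rewrite H1, H2. ring. }
  assert (E : (c1 * (A + - (Cconj c1 * c2) * B))%C = RtoC (Cmod A - Cmod B)).
  { replace (c1 * (A + - (Cconj c1 * c2) * B))%C
      with (c1 * A - (c1 * Cconj c1) * (c2 * B))%C by ring.
    rewrite E1, E2, Cmod_unit_inv, RtoC_minus by exact H1. ring. }
  assert (E' : Cmod (A + - (Cconj c1 * c2) * B) = Rabs (Cmod A - Cmod B)).
  { rewrite <- Cmod_R, <- E, Cmod_mult, H1. ring. }
  rewrite E'. apply Rabs_le. split.
  - pose proof (Cmod_triangle_rev (Cconj B) A) as K. rewrite Cmod_conj in K.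
    rewrite Cplus_comm in K. lra.
  - pose proof (Cmod_triangle_rev A (Cconj B)) as K. rewrite Cmod_conj in K. lra.
Qed.

Lemma growth_exhausts (L s : R) :
  1 <= L -> s < growth L (/ L) ->
  exists rho, 0 < rho < / L /\ s < growth L rho.
Proof.
  intros HL Hs.
  assert (Hi : 0 < / L) by (apply Rinv_0_lt_compat; lra).
  assert (HLL : / L * L = 1) by (apply Rinv_l; lra).
  (* For [L = 1] the point [/ L] is not below [L] and [is_derive_growth] does not reach it; there
     [growth] is the identity. *)
  destruct (Rle_lt_or_eq_dec _ _ HL) as [HL1|HL1].
  - assert (Hlt : / L < L) by nra.
    assert (Hc : continuous (growth L) (/ L)).
    { apply (ex_derive_continuous (V := R_NormedModule)).
      eexists. apply is_derive_growth; lra. }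
    destruct (Hc (fun y => s < y) (open_gt s _ Hs)) as [d Hd].
    pose proof (cond_pos d) as Hd0.
    pose (e := Rmin (d / 2) (/ L / 2)).
    pose proof (Rmin_l (d / 2) (/ L / 2)) as M1. fold e in M1.
    pose proof (Rmin_r (d / 2) (/ L / 2)) as M2. fold e in M2.
    assert (He : 0 < e) by (apply Rmin_pos; lra).
    exists (/ L - e). split; [lra|]. apply Hd.
    change (Rabs (/ L - e - / L) < d).
    replace (/ L - e - / L) with (- e) by ring.
    rewrite Rabs_Ropp, Rabs_pos_eq; lra.
  - subst L. rewrite Rinv_1 in *. rewrite growth_1 in Hs.
    exists ((Rmax s 0 + 1) / 2). rewrite growth_1.
    pose proof (Rmax_l s 0). pose proof (Rmax_r s 0).
    assert (Rmax s 0 < 1) by (apply Rmax_lub_lt; lra). lra.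
Qed.

Lemma growth_pos (L : R) : 1 <= L -> 0 < growth L (/ L).
Proof.
  intros HL. destruct (Rle_lt_or_eq_dec _ _ HL) as [HL1|<-].
  - rewrite <- (growth_0 L).
    assert (Hi : 0 < / L) by (apply Rinv_0_lt_compat; lra).
    assert (HLL : / L * L = 1) by (apply Rinv_l; lra).
    apply growth_lt; [lra|lra|lra|nra].
  - rewrite growth_1, Rinv_1. lra.
Qed.

(** Where the Jacobian is positive, [Lambda <= K * lambda] rearranges to this inequality. A possible
    branch point is a limit of such points, and [h'] and [g'] are continuous. *)
Lemma quasiregular_dilatation (K : R) (f h g : C -> C) (z : C) :
  quasiregular K f ->
  (forall z, unit_disk z -> dz f z = C_derive h z /\
                            dzbar f z = Cconj (C_derive g z)) ->
  ccont (C_derive h) z -> ccont (C_derive g) z -> unit_disk z ->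
  (K + 1) * Cmod (C_derive g z) <= (K - 1) * Cmod (C_derive h z).
Proof.
  intros [HK [_ [Hsp HLl]]] Hd Hh Hg Hz.
  assert (Hpos : forall w, unit_disk w -> 0 < jacobian f w ->
    (K + 1) * Cmod (C_derive g w) <= (K - 1) * Cmod (C_derive h w)).
  { intros w Hw HJ. specialize (HLl w Hw). destruct (Hd w Hw) as [E1 E2].
    unfold jacobian in HJ. unfold Lambda, lambda in HLl.
    rewrite E1, E2, Cmod_conj in HJ, HLl.
    pose proof (Cmod_ge_0 (C_derive g w)). pose proof (Cmod_ge_0 (C_derive h w)).
    assert (Cmod (C_derive g w) < Cmod (C_derive h w)) by nra.
    rewrite Rabs_pos_eq in HLl by lra. lra. }
  apply Rnot_lt_le. intros Hlt.
  set (h0 := Cmod (C_derive h z)) in *. set (g0 := Cmod (C_derive g z)) in *.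
  (* Perturbing both moduli by [e] costs [(K + 1) * e + (K - 1) * e = 2 * K * e], half of the
     supposed gap. *)
  set (e := ((K + 1) * g0 - (K - 1) * h0) / (4 * K)).
  assert (He : 0 < e) by (apply Rdiv_lt_0_compat; lra).
  destruct (Hsp z Hz) as [d [Hd0 HJ]].
  assert (Hball : cnear z (disk z d)) by (exists d; auto).
  destruct (cnear_punctured_point z _ (cnear_and _ _ _
    (cnear_and _ _ _ (Hh e He) (Hg e He))
    (cnear_and _ _ _ (cnear_disk _ _ _ Hz) Hball)))
    as [w [Hne [[K1 K2] [K3 K4]]]].
  pose proof (Hpos w K3 (HJ w K3 Hne K4)) as T.
  pose proof (Cmod_triangle_minus (C_derive h w) (C_derive h z)) as T1.
  pose proof (Cmod_triangle_minus (C_derive g z) (C_derive g w)) as T2.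
  rewrite (Cmod_minus_sym (C_derive g z)) in T2. fold h0 in T1. fold g0 in T2.
  assert (T3 : (K + 1) * (g0 - e) <= (K + 1) * Cmod (C_derive g w))
    by (apply Rmult_le_compat_l; lra).
  assert (T4 : (K - 1) * Cmod (C_derive h w) <= (K - 1) * (h0 + e))
    by (apply Rmult_le_compat_l; lra).
  assert (T5 : (4 * K) * e = (K + 1) * g0 - (K - 1) * h0)
    by (unfold e; field; lra).
  nra.
Qed.

Lemma landau_bloch (K M : R) (f h g : C -> C) :
  hypotheses K M f h g ->
  1 <= M /\
  univalent_on (disk 0%C (/ (2 * K * M / (K + 1)))) f /\
  contains_schlicht_disk f (disk 0%C (/ (2 * K * M / (K + 1)))) 0%C
    (growth (2 * K * M / (K + 1)) (/ (2 * K * M / (K + 1)))).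
Proof.
  intros [Hqr [[Hh [Hg Hf]] [Hf0 [Hl0 HM]]]].
  pose proof Hqr as [HK [Hharm _]].
  assert (Hdec : forall z, unit_disk z -> dz f z = C_derive h z /\
                                          dzbar f z = Cconj (C_derive g z)).
  { intros z Hz. apply (wirtinger_decomposition f h g).
    - eapply cnear_impl; [|exact (cnear_disk _ _ _ Hz)]. exact Hf.
    - now apply analytic_cderiv.
    - now apply analytic_cderiv. }
  destruct (harmonic_holo f Hharm) as [Hholo1 Hholo2].
  assert (Hhh : holo unit_disk (C_derive h)).
  { apply holo_ext_near with (dz f); [|exact Hholo1]. intros z Hz.
    eapply cnear_impl; [|exact (cnear_disk _ _ _ Hz)]. intros w Hw. now apply Hdec. }
  assert (Hgh : holo unit_disk (C_derive g)).
  { apply holo_ext_near with (fun z => Cconj (dzbar f z)); [|exact Hholo2].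
    intros z Hz. eapply cnear_impl; [|exact (cnear_disk _ _ _ Hz)].
    intros w Hw. destruct (Hdec w Hw) as [_ ->]. apply Cconj_conj. }
  assert (Hdil : forall z, unit_disk z ->
    (K + 1) * Cmod (C_derive g z) <= (K - 1) * Cmod (C_derive h z)).
  { intros z Hz. apply (quasiregular_dilatation K f h g); try assumption.
    - now apply holo_ccont with unit_disk.
    - now apply holo_ccont with unit_disk. }
  (* The dilatation inequality decides the sign inside the absolute value of [lambda], even though 0
     might be a branch point. *)
  assert (H0 : Cmod (C_derive h 0%C) - Cmod (C_derive g 0%C) = 1).
  { unfold lambda in Hl0. destruct (Hdec _ unit_disk_0) as [E1 E2].
    rewrite E1, E2, Cmod_conj in Hl0.
    pose proof (Hdil _ unit_disk_0). pose proof (Cmod_ge_0 (C_derive g 0%C)).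
    pose proof (Cmod_ge_0 (C_derive h 0%C)).
    assert (Cmod (C_derive g 0%C) <= Cmod (C_derive h 0%C)).
    { apply Rnot_lt_le. intros T. nra. }
    rewrite Rabs_pos_eq in Hl0; lra. }
  assert (HM1 : 1 <= M).
  { pose proof (HM _ unit_disk_0). pose proof (Cmod_ge_0 (C_derive g 0%C)). lra. }
  split; [exact HM1|].
  set (L := 2 * K * M / (K + 1)).
  assert (HLe : L * (K + 1) = 2 * K * M) by (unfold L; field; lra).
  assert (HL : 1 <= L) by nra.
  assert (Hi : 0 < / L) by (apply Rinv_0_lt_compat; lra).
  assert (HLL : / L * L = 1) by (apply Rinv_l; lra).
  assert (HiD : forall z, Cmod z < / L -> unit_disk z).
  { intros z Hz. apply unit_disk_Cmod. nra. }
  assert (Hsum : forall z, unit_disk z ->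
    Cmod (C_derive h z) + Cmod (C_derive g z) <= L).
  { intros z Hz. specialize (Hdil z Hz). specialize (HM z Hz).
    apply Rmult_le_reg_r with (K + 1); [lra|]. rewrite HLe. nra. }
  pose (F := fun e z => (h z + e * g z)%C).
  pose (phi := fun e z => (C_derive h z + e * C_derive g z)%C).
  assert (HF : forall e z, unit_disk z -> cderiv (F e) z (phi e z)).
  { intros e z Hz. apply cderiv_plus; [|apply cderiv_scal];
      now apply analytic_cderiv. }
  assert (Hphi : forall e, Cmod e = 1 -> exists c, Cmod c = 1 /\
    forall z, unit_disk z ->
      L * (1 - L * Cmod z) / (L - Cmod z) <= Re (c * phi e z)).
  { intros e He. apply derivative_lower_bound.
    - apply holo_plus; [exact Hhh|]. apply holo_mult; [apply holo_const|exact Hgh].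
    - pose proof (Cmod_triangle_rev (C_derive h 0%C) (e * C_derive g 0%C)) as T.
      rewrite Cmod_mult, He in T. unfold phi. lra.
    - intros z Hz. unfold phi. eapply Rle_trans; [apply Cmod_triangle|].
      rewrite Cmod_mult, He, Rmult_1_l. now apply Hsum. }
  (* The Schwarz-Pick bound decreases with the radius: after cross-multiplication the difference is
     [L * (L ^ 2 - 1) * (rho - r)]. *)
  assert (Hmu : forall r rho, 0 <= r <= rho -> rho < / L ->
    0 < L * (1 - L * rho) / (L - rho) <= L * (1 - L * r) / (L - r)).
  { intros r rho Hr Hrho.
    assert (L * rho < 1) by nra. assert (rho < L) by nra. split.
    - apply Rdiv_lt_0_compat; [|lra]. apply Rmult_lt_0_compat; lra.
    - apply Rmult_le_reg_r with ((L - rho) * (L - r)).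
      + apply Rmult_lt_0_compat; lra.
      + replace (L * (1 - L * rho) / (L - rho) * ((L - rho) * (L - r)))
          with (L * ((1 - L * rho) * (L - r))) by (field; lra).
        replace (L * (1 - L * r) / (L - r) * ((L - rho) * (L - r)))
          with (L * ((1 - L * r) * (L - rho))) by (field; lra).
        apply Rmult_le_compat_l; [lra|].
        assert (0 <= (L ^ 2 - 1) * (rho - r)) by (apply Rmult_le_pos; nra).
        nra. }
  assert (Hdf : forall e z1 z2, unit_disk z1 -> unit_disk z2 ->
    (f z2 - f z1)%C = ((h z2 - h z1) + Cconj (g z2 - g z1))%C /\
    (F e z2 - F e z1)%C = ((h z2 - h z1) + e * (g z2 - g z1))%C).
  { intros e z1 z2 H1 H2. rewrite (Hf _ H1), (Hf _ H2), Cminus_conj. unfold F.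
    split; ring. }
  assert (Hlip : forall rho, rho < / L -> exists k, 0 < k /\
    forall z1 z2, Cmod z1 <= rho -> Cmod z2 <= rho ->
      k * Cmod (z2 - z1) <= Cmod (f z2 - f z1)).
  (* [rho0] may be negative, whereas [Hmu] concerns radii that are not. *)
  { intros rho0 Hrho0. pose (rho := Rmax rho0 0).
    assert (Hrho : 0 <= rho < / L).
    { split; [apply Rmax_r | apply Rmax_lub_lt; lra]. }
    pose proof (Rmax_l rho0 0) as Hrr. fold rho in Hrr.
    exists (L * (1 - L * rho) / (L - rho)). split.
    { apply (Hmu rho rho); lra. }
    intros z1 z2 H1 H2.
    assert (D1 : unit_disk z1) by (apply HiD; lra).
    assert (D2 : unit_disk z2) by (apply HiD; lra).
    (* [e], and with it [c], depends on the two points, but the constant [k] does not. *)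
    destruct (aligning_unit (h z2 - h z1) (g z2 - g z1)) as [e [He Hal]].
    destruct (Hdf e z1 z2 D1 D2) as [E1 E2].
    rewrite <- E1, <- E2 in Hal. eapply Rle_trans; [|exact Hal].
    destruct (Hphi e He) as [c [Hc Hlow]].
    apply (lipschitz_lower_bound (F e) (phi e) c rho); [exact Hc| | |lra|lra].
    - intros z Hz. apply HF, HiD. lra.
    - intros z Hz. eapply Rle_trans; [|apply Hlow, HiD; lra].
      apply Hmu; [|lra]. split; [apply Cmod_ge_0|exact Hz]. }
  assert (Hgrow : forall z, Cmod z < / L -> growth L (Cmod z) <= Cmod (f z)).
  { intros z Hz.
    destruct (aligning_unit (h z - h 0%C) (g z - g 0%C)) as [e [He Hal]].
    destruct (Hdf e 0%C z unit_disk_0 (HiD z Hz)) as [E1 E2].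
    rewrite <- E1, <- E2, Hf0 in Hal.
    replace (f z - 0)%C with (f z) in Hal by ring.
    eapply Rle_trans; [|exact Hal]. destruct (Hphi e He) as [c [Hc Hlow]].
    apply (growth_lower_bound (F e) (phi e) c L); auto. }
  assert (Hdiff : forall z, Cmod z < / L -> forall eps, 0 < eps ->
    cnear z (fun w => Cmod (f w - f z - (C_derive h z * (w - z) +
      Cconj (C_derive g z) * Cconj (w - z))) <= eps * Cmod (w - z))).
  { intros z Hz eps Heps. assert (D : unit_disk z) by now apply HiD.
    assert (He2 : 0 < eps / 2) by lra.
    pose proof (proj1 (cderiv_eps _ _ _) (analytic_cderiv h z Hh D) _ He2) as K1.
    pose proof (proj1 (cderiv_eps _ _ _) (analytic_cderiv g z Hg D) _ He2) as K2.
    eapply cnear_impl; [|exact (cnear_and _ _ _ (cnear_disk _ _ _ D)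
                                 (cnear_and _ _ _ K1 K2))].
    intros w [Dw [T1 T2]]. cbv beta in T1, T2.
    destruct (Hdf 1%C z w D Dw) as [-> _].
    replace (h w - h z + Cconj (g w - g z) - (C_derive h z * (w - z) +
      Cconj (C_derive g z) * Cconj (w - z)))%C
      with ((h w - h z - C_derive h z * (w - z)) +
            Cconj (g w - g z - C_derive g z * (w - z)))%C.
    2:{ rewrite !(Cminus_conj (g w - g z)), Cmult_conj. ring. }
    eapply Rle_trans; [apply Cmod_triangle|]. rewrite Cmod_conj. lra. }
  (* No branch point lies in this disk: the bound for [F_1'] prevents [h'] and [g'] from vanishing
     together, and then the dilatation inequality forces [|g'| < |h'|]. *)
  assert (Hjac : forall z, Cmod z < / L ->
    Cmod (Cconj (C_derive g z)) < Cmod (C_derive h z)).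
  { intros z Hz. assert (D : unit_disk z) by now apply HiD.
    rewrite Cmod_conj. specialize (Hdil z D).
    pose proof (Cmod_ge_0 (C_derive g z)) as Hg0.
    destruct (Hphi 1%C Cmod_1) as [c [Hc Hlow]]. specialize (Hlow z D).
    destruct (Hmu (Cmod z) (Cmod z)) as [Hp _];
      [split; [apply Cmod_ge_0|lra]|exact Hz|].
    assert (Hpos : 0 < Cmod (C_derive h z) + Cmod (C_derive g z)).
    { eapply Rlt_le_trans; [exact Hp|]. eapply Rle_trans; [exact Hlow|].
      eapply Rle_trans; [apply Rle_abs|]. eapply Rle_trans; [apply re_le_Cmod|].
      rewrite Cmod_mult, Hc, Rmult_1_l. unfold phi.
      eapply Rle_trans; [apply Cmod_triangle|]. rewrite Cmod_mult, Cmod_1. lra. }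
    nra. }
  split.
  - exact (schlicht_univalent f (/ L) Hlip).
  - apply (schlicht_disk f (C_derive h) (fun z => Cconj (C_derive g z)) (growth L));
      try assumption.
    + intros s Hs. now apply growth_exhausts.
    + now apply growth_pos.
Qed.

Lemma r6_inv (K M : R) : 0 < K -> 0 < M -> r6 K M = / (2 * K * M / (K + 1)).
Proof. intros HK HM. unfold r6. field. lra. Qed.

Lemma r7_growth (K M : R) :
  0 < K -> 0 < M ->
  r7 K M = growth (2 * K * M / (K + 1)) (/ (2 * K * M / (K + 1))).
Proof.
  intros HK HM. unfold r7, growth. set (L := 2 * K * M / (K + 1)).
  assert (HL : 0 < L).
  { apply Rdiv_lt_0_compat; [|lra]. apply Rmult_lt_0_compat; lra. }
  replace ((K + 1) / (2 * K * M)) with (/ L) by (unfold L; field; lra).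
  replace (/ L / L) with ((/ L) ^ 2) by (field; lra).
  field. lra.
Qed.

(** * The extremal function *)

Lemma holo_ex_diff_1 (F : C -> C) (z : C) :
  holo unit_disk F -> unit_disk z ->
  ex_diff_n (fun x y => Re (F (x, y))) 1 (Re z) (Im z).
Proof.
  intros HF Hz. pose proof HF as [F1 H].
  destruct (cderiv_partials F z (F1 z) (proj1 (H z Hz))) as [P1 [_ [P2 _]]].
  pose proof (holo_ccont _ _ _ HF Hz) as HC. apply ccont_2d in HC.
  pose proof (proj2 (H z Hz)) as HC1. apply ccont_2d in HC1.
  split; [apply HC|]. split; [eexists; exact P1|]. split; [eexists; exact P2|].
  split; (split; [|exact I]).
  - apply continuity_2d_pt_ext_loc with (fun x y => Re (F1 (x, y))); [|apply HC1].
    apply unit_disk_locally_2d; [exact Hz|]. intros w Hw. symmetry.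
    apply is_derive_unique. destruct w as [x y].
    apply (cderiv_partials F (x, y)). now apply H.
  - apply continuity_2d_pt_ext_loc with (fun x y => - Im (F1 (x, y))).
    2:{ apply continuity_2d_pt_opp, HC1. }
    apply unit_disk_locally_2d; [exact Hz|]. intros w Hw. symmetry.
    apply is_derive_unique. destruct w as [x y].
    apply (cderiv_partials F (x, y)). now apply H.
Qed.

Lemma holo_ex_diff_2 (F phi : C -> C) (z : C) :
  (forall w, unit_disk w -> cderiv F w (phi w)) -> holo unit_disk phi ->
  unit_disk z -> ex_diff_n (fun x y => Re (F (x, y))) 2 (Re z) (Im z).
Proof.
  intros HF Hphi Hz.
  destruct (cderiv_partials F z (phi z) (HF z Hz)) as [P1 [_ [P2 _]]].
  pose proof (cderiv_ccont _ _ _ (HF z Hz)) as HC. apply ccont_2d in HC.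
  split; [apply HC|]. split; [eexists; exact P1|]. split; [eexists; exact P2|].
  split.
  - apply ex_diff_n_ext_loc with (fun x y => Re (phi (x, y)));
      [|now apply holo_ex_diff_1].
    apply unit_disk_locally_2d; [exact Hz|]. intros w Hw. symmetry.
    apply is_derive_unique. destruct w as [x y].
    apply (cderiv_partials F (x, y)). now apply HF.
  (* The partial derivative of [Re F] in [y] is [- Im phi = Re (i phi)], again the real part of a
     holomorphic function. *)
  - apply ex_diff_n_ext_loc with (fun x y => Re (Ci * phi (x, y))).
    + apply unit_disk_locally_2d; [exact Hz|]. intros w Hw. symmetry.
      apply is_derive_unique. destruct w as [x y].
      replace (Re (Ci * phi (Re (x, y), Im (x, y)))) with (- Im (phi (x, y)))
        by (cparts; ring).
      apply (cderiv_partials F (x, y)). now apply HF.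
    + apply (holo_ex_diff_1 (fun w => Ci * phi w)%C); [|exact Hz].
      apply holo_mult; [apply holo_const | exact Hphi].
Qed.

Lemma holo_C2 (F phi : C -> C) :
  (forall w, unit_disk w -> cderiv F w (phi w)) -> holo unit_disk phi ->
  C2_on_disk F.
Proof.
  intros HF Hphi z Hz. split.
  - now apply (holo_ex_diff_2 F phi).
  - apply ex_diff_n_ext_loc with (fun x y => Re (- Ci * F (x, y))).
    + apply locally_2d_forall. intros x y. cparts. ring.
    + apply (holo_ex_diff_2 (fun w => - Ci * F w)%C (fun w => - Ci * phi w)%C).
      * intros w Hw. apply cderiv_scal. now apply HF.
      * apply holo_mult; [apply holo_const | exact Hphi].
      * exact Hz.
Qed.

Lemma analytic_wirtinger (F : C -> C) (z l : C) :
  cderiv F z l -> dz F z = l /\ dzbar F z = 0%C.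
Proof.
  intros H. destruct (wirtinger_decomposition F F (fun _ => 0%C) z l 0%C) as [E1 E2].
  - exists 1. split; [lra|]. intros w _.
    apply injective_projections; cparts; ring.
  - exact H.
  - apply cderiv_const.
  - split; [exact E1|]. rewrite E2. apply injective_projections; cparts; ring.
Qed.

Lemma dzbar_ext_near (F G : C -> C) (z : C) :
  cnear z (fun w => F w = G w) -> dzbar F z = dzbar G z.
Proof.
  intros H. unfold dzbar, dx, dy.
  pose proof (cnear_re _ _ H) as Hr. pose proof (cnear_im _ _ H) as Hi.
  rewrite (Derive_ext_loc (fun t => Re (F (t, Im z))) (fun t => Re (G (t, Im z))))
    by (revert Hr; apply filter_imp; intros t Et; apply f_equal; exact Et).
  rewrite (Derive_ext_loc (fun t => Im (F (t, Im z))) (fun t => Im (G (t, Im z))))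
    by (revert Hr; apply filter_imp; intros t Et; apply f_equal; exact Et).
  rewrite (Derive_ext_loc (fun t => Re (F (Re z, t))) (fun t => Re (G (Re z, t))))
    by (revert Hi; apply filter_imp; intros t Et; apply f_equal; exact Et).
  rewrite (Derive_ext_loc (fun t => Im (F (Re z, t))) (fun t => Im (G (Re z, t))))
    by (revert Hi; apply filter_imp; intros t Et; apply f_equal; exact Et).
  reflexivity.
Qed.

(** * A primitive of the extremal integrand *)

Lemma RtoC_minus_neq_0 (M : R) (w : C) : Re w < M -> (M - w)%C <> 0%C.
Proof.
  intros Hw E. pose proof (f_equal fst E) as E1. revert E1 Hw. cparts. lra.
Qed.

(* A branch of [log (M - w)] on the half-plane [Re w < M]. *)
Definition clog (M : R) (w : C) : C :=
  (/ 2 * ln ((M - Re w) ^ 2 + Im w ^ 2), - atan (Im w / (M - Re w))).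

Lemma cderiv_clog (M : R) (w : C) : Re w < M -> cderiv (clog M) w (- / (M - w))%C.
Proof.
  intros Hw.
  assert (HN : forall x y, x < M -> 0 < (M - x) ^ 2 + y ^ 2).
  { intros x y Hx. assert (0 < (M - x) ^ 2) by (apply pow_lt; lra).
    pose proof (pow2_ge_0 y). lra. }
  assert (Hnear : locally_2d (fun x _ => x < M) (Re w) (Im w)).
  { assert (Hp : 0 < M - Re w) by lra.
    exists (mkposreal _ Hp). simpl. intros u v Hu _. apply Rabs_def2 in Hu. lra. }
  assert (HC : ccont (fun v => - / (M - v))%C w).
  { apply ccont_opp, ccont_inv; [|now apply RtoC_minus_neq_0].
    apply ccont_minus; [apply ccont_const | apply ccont_id]. }
  apply ccont_2d in HC.
  assert (Hpart : forall (U V : R -> R -> R) l,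
    (forall x y, x < M -> is_derive (fun t => U t y) x (V x y)) ->
    is_derive (fun t => U (Re w) t) (Im w) l ->
    continuity_2d_pt V (Re w) (Im w) ->
    differentiable_pt_lim U (Re w) (Im w) (V (Re w) (Im w)) l).
  { intros U V l H1 H2 H3. apply filterdiff_differentiable_pt_lim.
    eapply filterdiff_ext_lin; [apply (is_derive_filterdiff U _ _ V l)|].
    - apply locally_2d_locally in Hnear. revert Hnear. apply filter_imp.
      intros [u v] Hu. now apply H1.
    - exact H2.
    - apply continuity_2d_pt_filterlim in H3. exact H3.
    - intros [u v]. reflexivity. }
  rewrite (surjective_pairing (- / (M - w))%C).
  apply cauchy_riemann_cderiv.
  - destruct w as [a b].
    apply (Hpart _ (fun x y => Re (- / (M - (x, y)))%C)).
    + intros x y Hx. unfold clog. cparts. pose proof (HN x y Hx) as Hp.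
      auto_derive; [lra|]. field. intros E; lra.
    + unfold clog. cparts. pose proof (HN a b Hw) as Hp.
      auto_derive; [lra|]. field. intros E; lra.
    + apply HC.
  - destruct w as [a b].
    apply (Hpart _ (fun x y => Im (- / (M - (x, y)))%C)).
    + intros x y Hx. unfold clog. cparts. pose proof (HN x y Hx) as Hp.
      auto_derive; [lra|]. field. repeat split; intros E; lra.
    + unfold clog. cparts. pose proof (HN a b Hw) as Hp. unfold Re in Hw. simpl in Hw.
      auto_derive; [lra|]. field. repeat split; intros E; lra.
    + apply HC.
Qed.

Definition extremal_deriv (M : R) (w : C) : C := (M * ((1 - M * w) / (M - w)))%C.

(** Division with remainder gives [M (1 - M w) / (M - w) = M^2 - M (M^2 - 1) / (M - w)], and
    [clog M] has derivative [- 1 / (M - w)]. *)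
Definition extremal_primitive (M : R) (w : C) : C :=
  ((M ^ 2)%R * w + (M * (M ^ 2 - 1))%R * clog M w)%C.

Lemma unit_disk_re_lt (M : R) (z : C) : 1 < M -> unit_disk z -> Re z < M.
Proof.
  intros HM Hz. rewrite unit_disk_Cmod in Hz.
  pose proof (re_le_Cmod z). pose proof (Rle_abs (Re z)). lra.
Qed.

Lemma cderiv_extremal_primitive (M : R) (w : C) :
  Re w < M -> cderiv (extremal_primitive M) w (extremal_deriv M w).
Proof.
  intros Hw. pose proof (RtoC_minus_neq_0 M w Hw) as Hne.
  replace (extremal_deriv M w) with
    ((M ^ 2)%R * 1 + (M * (M ^ 2 - 1))%R * (- / (M - w)))%C.
  - apply cderiv_plus; apply cderiv_scal;
      [apply cderiv_id | now apply cderiv_clog].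
  - unfold extremal_deriv.
    rewrite RtoC_mult, RtoC_minus. replace (RtoC (M ^ 2)) with (M * M)%C
      by (rewrite <- RtoC_mult; f_equal; ring).
    field. exact Hne.
Qed.

Lemma holo_extremal_deriv (M : R) : holo (fun w => Re w < M) (extremal_deriv M).
Proof.
  apply holo_mult; [apply holo_const|]. apply holo_div.
  - apply holo_minus; [apply holo_const|].
    apply holo_mult; [apply holo_const | apply holo_id].
  - apply holo_minus; [apply holo_const | apply holo_id].
  - intros w Hw. now apply RtoC_minus_neq_0.
Qed.

Lemma extremal_closed_form (M : R) (z : C) :
  1 < M -> unit_disk z ->
  extremal M z = (extremal_primitive M z - extremal_primitive M 0%C)%C.
Proof.
  intros HM Hz.
  assert (Hseg : forall t, 0 <= t <= 1 -> Re (0 + t * z) < M).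
  { intros t Ht. apply unit_disk_re_lt; [exact HM|]. rewrite unit_disk_Cmod in *.
    apply Rle_lt_trans with (Cmod z); [|exact Hz].
    replace (0 + t * z)%C with (0 + t * (z - 0))%C by ring.
    apply segment_in_closed_disk; [|lra|exact Ht].
    rewrite Cmod_0. apply Cmod_ge_0. }
  destruct (holo_extremal_deriv M) as [phi1 Hphi].
  (* One real statement for both components of the integral: [c = 1] yields the real part and
     [c = - i] the imaginary part. *)
  assert (Hint : forall c : C,
    is_RInt (fun t : R => Re (c * extremal_deriv M (0 + t * z)%C * z)) 0 1
      (Re (c * extremal_primitive M z) - Re (c * extremal_primitive M 0%C))).
  { intros c.
    replace (extremal_primitive M z) with (extremal_primitive M (0 + 1 * z)%C)
      by (f_equal; ring).
    replace (extremal_primitive M 0%C) with (extremal_primitive M (0 + 0 * z)%C)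
      by (f_equal; ring).
    apply (is_RInt_derive (V := R_CompleteNormedModule)
      (fun t : R => Re (c * extremal_primitive M (0 + t * z)%C))).
    - intros t Ht. rewrite Rmin_left, Rmax_right in Ht by lra.
      apply is_derive_segment. apply cderiv_extremal_primitive. now apply Hseg.
    - intros t Ht. rewrite Rmin_left, Rmax_right in Ht by lra.
      apply continuous_ext with
        (fun s : R => Re (c * z * extremal_deriv M (0 + s * z)%C)).
      { intros s. f_equal. ring. }
      apply (ex_derive_continuous (V := R_NormedModule)). eexists.
      apply is_derive_segment. apply Hphi. now apply Hseg. }
  unfold extremal, segment_integral.
  apply (is_RInt_unique (V := C_R_CompleteNormedModule)).
  rewrite (surjective_pairing (extremal_primitive M z - extremal_primitive M 0%C)%C).
  apply (is_RInt_fct_extend_pair (U := R_NormedModule) (V := R_NormedModule)).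
  - pose proof (Hint 1%C) as H.
    replace (Re (1 * extremal_primitive M z) - Re (1 * extremal_primitive M 0%C))
      with (fst (extremal_primitive M z - extremal_primitive M 0%C)%C) in H
      by (cparts; ring).
    eapply is_RInt_ext; [|exact H]. intros t _. cbv beta.
    change (Re (1 * extremal_deriv M (0 + t * z) * z) =
      Re (extremal_deriv M (0 + t * (z - 0)) * (z - 0))).
    replace (z - 0)%C with z by ring. f_equal. ring.
  - pose proof (Hint (- Ci)%C) as H.
    replace (Re (- Ci * extremal_primitive M z) - Re (- Ci * extremal_primitive M 0%C))
      with (snd (extremal_primitive M z - extremal_primitive M 0%C)%C) in H
      by (cparts; ring).
    eapply is_RInt_ext; [|exact H]. intros t _. cbv beta.
    change (Re (- Ci * extremal_deriv M (0 + t * z) * z) =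
      Im (extremal_deriv M (0 + t * (z - 0)) * (z - 0))).
    replace (z - 0)%C with z by ring.
    generalize (extremal_deriv M (0 + t * z)). intros w. cparts. ring.
Qed.

Lemma cderiv_extremal (M : R) (z : C) :
  1 < M -> unit_disk z -> cderiv (extremal M) z (extremal_deriv M z).
Proof.
  intros HM Hz.
  apply cderiv_ext_near with
    (fun w => extremal_primitive M w - extremal_primitive M 0%C)%C.
  - eapply cnear_impl; [|exact (cnear_disk _ _ _ Hz)].
    intros w Hw. symmetry. now apply extremal_closed_form.
  - replace (extremal_deriv M z) with (extremal_deriv M z - 0)%C by ring.
    apply cderiv_minus; [|apply cderiv_const].
    apply cderiv_extremal_primitive. now apply unit_disk_re_lt.
Qed.

(** [extremal_deriv M] is [M] times the Blaschke factor with zero [1 / M]. *)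
Lemma extremal_deriv_le (M : R) (z : C) :
  1 < M -> unit_disk z -> Cmod (extremal_deriv M z) <= M.
Proof.
  intros HM Hz. pose proof (unit_disk_re_lt M z HM Hz) as Hre.
  pose proof (RtoC_minus_neq_0 M z Hre) as Hne.
  rewrite unit_disk_Cmod in Hz. pose proof (Cmod_ge_0 z) as Hz0.
  unfold extremal_deriv.
  rewrite Cmod_mult, Cmod_div, Cmod_R, Rabs_pos_eq by (exact Hne || lra).
  apply Cmod_gt_0 in Hne.
  assert (E : Cmod (M - z) ^ 2 - Cmod (1 - M * z) ^ 2 =
    (M ^ 2 - 1) * (1 - Cmod z ^ 2)).
  { rewrite !Cmod2_alt. cparts. ring. }
  assert (0 <= (M ^ 2 - 1) * (1 - Cmod z ^ 2)) by (apply Rmult_le_pos; nra).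
  assert (Cmod (1 - M * z) <= Cmod (M - z)).
  { apply Rsqr_incr_0_var; unfold Rsqr; nra. }
  apply Rle_trans with (M * 1); [|lra]. apply Rmult_le_compat_l; [lra|].
  apply Rmult_le_reg_r with (Cmod (M - z)); [exact Hne|].
  unfold Rdiv. rewrite Rmult_assoc, Rinv_l by lra. lra.
Qed.

Lemma extremal_deriv_ne0 (M : R) (z : C) :
  1 < M -> unit_disk z -> z <> RtoC (/ M) -> extremal_deriv M z <> 0%C.
Proof.
  intros HM Hz Hne. pose proof (unit_disk_re_lt M z HM Hz) as Hre.
  pose proof (RtoC_minus_neq_0 M z Hre) as HMz.
  assert (HM0 : RtoC M <> 0%C) by (intros E; injection E; lra).
  unfold extremal_deriv, Cdiv. repeat apply Cmult_neq_0; [exact HM0| |].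
  - intros E. apply Hne. rewrite RtoC_inv by lra.
    replace z with ((1 - (1 - M * z)) / M)%C by (field; exact HM0).
    rewrite E. field. exact HM0.
  - intros E. pose proof (Cinv_r _ HMz) as K. rewrite E, Cmult_0_r in K.
    injection K. lra.
Qed.

Lemma extremal_hypotheses (M : R) :
  1 < M -> hypotheses 1 M (extremal M) (extremal M) (fun _ => 0%C).
Proof.
  intros HM.
  assert (Hholo : holo unit_disk (extremal_deriv M)).
  { eapply holo_subset; [|apply (holo_extremal_deriv M)].
    intros w Hw. now apply unit_disk_re_lt. }
  assert (Hd : forall z, unit_disk z -> cderiv (extremal M) z (extremal_deriv M z)).
  { intros z Hz. now apply cderiv_extremal. }
  assert (Hw : forall z, unit_disk z ->
    dz (extremal M) z = extremal_deriv M z /\ dzbar (extremal M) z = 0%C).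
  { intros z Hz. apply analytic_wirtinger. now apply Hd. }
  split; [split; [lra|split; [split|split]]|split; [split; [|split]|split; [|split]]].
  - exact (holo_C2 _ _ Hd Hholo).
  - intros z Hz. rewrite (dzbar_ext_near _ (extremal_deriv M)).
    + destruct Hholo as [phi1 H]. destruct (H z Hz) as [H1 _].
      rewrite (proj2 (analytic_wirtinger _ _ _ H1)). ring.
    + eapply cnear_impl; [|exact (cnear_disk _ _ _ Hz)].
      intros w Hw'. now apply Hw.
  - intros z0 Hz0.
    assert (HJ : forall z, unit_disk z -> z <> RtoC (/ M) ->
      0 < jacobian (extremal M) z).
    { intros z Hz Hne. unfold jacobian. destruct (Hw z Hz) as [-> ->].
      rewrite Cmod_0. pose proof (extremal_deriv_ne0 M z HM Hz Hne) as K.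
      apply Cmod_gt_0 in K. nra. }
    (* The only branch point is [/ M]. Around it any punctured neighbourhood will do; around another
       point the radius must exclude it. *)
    destruct (excluded_middle_informative (z0 = RtoC (/ M))) as [->|Hne].
    + exists 1. split; [lra|]. intros z Hz Hzz _. now apply HJ.
    + destruct (cnear_neq _ _ Hne) as [d [Hd0 K]]. exists d. split; [exact Hd0|].
      intros z Hz _ Hzd. apply HJ; [exact Hz|]. now apply K.
  - intros z Hz. unfold Lambda, lambda. destruct (Hw z Hz) as [_ ->].
    rewrite Cmod_0, Rminus_0_r, Rabs_pos_eq by apply Cmod_ge_0. lra.
  - intros z Hz. exists (extremal_deriv M z). apply is_derive_cderiv. now apply Hd.
  - intros z _. exists (RtoC 0). apply is_derive_cderiv. apply cderiv_const.
  - intros z _. apply injective_projections; cparts; ring.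
  - rewrite extremal_closed_form by (exact HM || exact unit_disk_0). ring.
  - unfold lambda. destruct (Hw _ unit_disk_0) as [-> ->].
    replace (extremal_deriv M 0%C) with (RtoC 1).
    + rewrite Cmod_0, Cmod_1, Rminus_0_r. apply Rabs_R1.
    + unfold extremal_deriv. field. intros E. injection E. lra.
  - intros z Hz. rewrite (is_C_derive_unique _ _ (extremal_deriv M z)).
    + now apply extremal_deriv_le.
    + apply is_derive_cderiv. now apply Hd.
Qed.

(** On the real diameter the extremal function is [growth] itself with [L = M], the value of
    [2KM/(K+1)] at [K = 1]; failure of injectivity becomes a question about a real function. *)
Lemma extremal_real (M x : R) :
  1 < M -> -1 < x < 1 -> extremal M (RtoC x) = RtoC (growth M x).
Proof.
  intros HM Hx. rewrite extremal_closed_form; [|exact HM|].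
  2:{ apply unit_disk_Cmod. rewrite Cmod_R. now apply Rabs_def1. }
  assert (Hln : forall y, y < M -> / 2 * ln ((M - y) ^ 2 + 0 ^ 2) = ln (M - y)).
  { intros y Hy. replace ((M - y) ^ 2 + 0 ^ 2) with ((M - y) * (M - y)) by ring.
    rewrite ln_mult by lra. field. }
  assert (Hd : ln (1 - x / M) = ln (M - x) - ln (M - 0)).
  { rewrite <- ln_div by lra. f_equal. field. lra. }
  unfold extremal_primitive, clog, growth. rewrite Hd.
  apply injective_projections; cparts; rewrite ?Hln by lra.
  - ring.
  - replace (0 / (M - x)) with 0 by (unfold Rdiv; ring).
    replace (0 / (M - 0)) with 0 by (unfold Rdiv; ring).
    rewrite atan_0. ring.
Qed.

(* On the real axis the extremal function increases up to its critical point
   [1 / M] and decreases afterwards. *)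
Lemma extremal_not_univalent (M r : R) :
  1 < M -> 1 / M < r <= 1 -> ~ univalent_on (disk 0%C r) (extremal M).
Proof.
  intros HM Hr Hu.
  assert (Hi : 0 < / M) by (apply Rinv_0_lt_compat; lra).
  assert (HMM : / M * M = 1) by (apply Rinv_l; lra).
  replace (1 / M) with (/ M) in Hr by (unfold Rdiv; ring).
  assert (Hinj : forall x y, 0 <= x < r -> 0 <= y < r ->
    growth M x = growth M y -> x = y).
  { intros x y Hx Hy E.
    assert (E2 : RtoC x = RtoC y).
    { apply Hu.
      - apply disk_Cmod. rewrite Cmod_R, Rabs_pos_eq; lra.
      - apply disk_Cmod. rewrite Cmod_R, Rabs_pos_eq; lra.
      - rewrite !extremal_real by lra. now rewrite E. }
    now injection E2. }
  set (b := (/ M + r) / 2).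
  assert (Hb : / M < b < r) by (unfold b; lra).
  assert (H0 : growth M 0 < growth M (/ M)) by (apply growth_lt; lra).
  assert (Hd : forall x, x < M ->
    derivable_pt_lim (growth M) x (M * (1 - M * x) / (M - x))).
  { intros x Hx. apply is_derive_Reals. apply is_derive_growth; lra. }
  assert (Hc : forall x, x < M -> continuity_pt (growth M) x).
  { intros x Hx. apply derivable_continuous_pt. eexists. now apply Hd. }
  assert (H1 : growth M b < growth M (/ M)).
  { destruct (MVT_cor2 (growth M) (fun x => M * (1 - M * x) / (M - x)) (/ M) b)
      as [x [E Hx]]; [lra|intros x Hx; apply Hd; lra|].
    assert (M * (1 - M * x) / (M - x) < 0).
    { apply Ropp_lt_cancel. rewrite Ropp_0.
      replace (- (M * (1 - M * x) / (M - x))) with (M * (M * x - 1) / (M - x))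
        by (field; lra).
      apply Rdiv_lt_0_compat; [|lra]. apply Rmult_lt_0_compat; [lra|]. nra. }
    nra. }
  (* The larger of the two end values is taken again on the other side of the peak: that of [b] on
     [[0, / M]], or that of 0 on [[/ M, b]]. The sign change in the second case gives the
     intermediate value theorem its increasing end values. *)
  destruct (Rle_lt_dec (growth M 0) (growth M b)) as [Hle|Hlt].
  - destruct (f_interv_is_interv (growth M) 0 (/ M) (growth M b)) as [x [Hx E]];
      [lra|lra|intros x Hx; apply Hc; lra|].
    assert (x = b) by (apply Hinj; lra). lra.
  - destruct (f_interv_is_interv (fun x => - growth M x) (/ M) b (- growth M 0))
      as [x [Hx E]]; [lra|lra| |].
    { intros x Hx. apply continuity_pt_opp. apply Hc. lra. }
    assert (x = 0) by (apply Hinj; lra). lra.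
Qed.

Theorem theorem3p4 :
  (forall (K M : R) (f h g : C -> C),
     1 <= K ->
     hypotheses K M f h g ->
     1 <= M /\
     (1 < M \/ (M = 1 /\ 1 < K) ->
        univalent_on (disk 0%C (r6 K M)) f /\
        contains_schlicht_disk f (disk 0%C (r6 K M)) 0%C (r7 K M)) /\
     (M = 1 /\ K = 1 ->
        univalent_on unit_disk f /\
        contains_schlicht_disk f unit_disk 0%C 1)) /\
  (forall M : R,
     1 < M ->
     hypotheses 1 M (extremal M) (extremal M) (fun _ => 0%C) /\
     forall r : R, 1 / M < r <= 1 ->
       ~ univalent_on (disk 0%C r) (extremal M)).
Proof.
  split.
  - intros K M f h g HK Hyp.
    destruct (landau_bloch K M f h g Hyp) as [HM [Hu Hs]].
    split; [exact HM|]. split.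
    + intros _. rewrite r6_inv, r7_growth by lra. now split.
    + intros [-> ->].
      replace (2 * 1 * 1 / (1 + 1)) with 1 in Hu, Hs by field.
      rewrite growth_1, Rinv_1 in Hs. rewrite Rinv_1 in Hu. now split.
  - intros M HM. split; [now apply extremal_hypotheses|].
    intros r Hr. now apply extremal_not_univalent.
Qed.
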